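(* Let $\{\psi_{i,x}\}_{i=1}^\infty$ and $\{\psi_{i,u}\}_{i=1}^\infty$ be (linearly independent and complete) Riesz bases of $\mathcal{H}_x$ and $\mathcal{H}_u$, respectively. Let $F:X\times U\to X$ satisfy $\psi_{i,x}\circ F\in\mathcal{H}$ for all $i\in\mathbb{N}$. Let $\{\psi_l\}_{l=1}^\infty$ be an enumeration of the products $\psi_{i,x}(x)\psi_{j,u}(u)$, $i,j\in\mathbb{N}$. Then there exists an infinite-dimensional matrix $\mathcal{K}=Q_xR^{-1}$ such that $$\Psi_x(F(x,u))=\mathcal{K}\,\Psi(x,u)=\mathcal{K}\,(\Psi_x(x)\otimes\Psi_u(u)),$$ where the infinite matrices $R$ and $Q_x$ are given by $$[R]_{ij}=\langle\psi_i,\psi_j\rangle_{\mathcal{H}},\qquad [Q_x]_{ij}=\langle\psi_{i,x}\circ F,\psi_j\rangle_{\mathcal{H}},\qquad i,j\in\mathbb{N}.$$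
   Context: $(X,\Sigma_x,\mu_x)$, $(U,\Sigma_u,\mu_u)$ are $\sigma$-finite measure spaces, $X\subseteq\mathbb{R}^n$, $U\subseteq\mathbb{R}^m$; $\mathcal{H}_x=L^2(X,\mu_x)$, $\mathcal{H}_u=L^2(U,\mu_u)$, and $\mathcal{H}=L^2(X\times U,\mu_x\otimes\mu_u)\cong\mathcal{H}_x\otimes\mathcal{H}_u$, functions being $\mathbb{K}$-valued with $\mathbb{K}=\mathbb{R}$ or $\mathbb{C}$, inner product $\langle f_1,f_2\rangle=\int f_1\overline{f_2}$. $F:X\times U\to X$ is a measurable, Lebesgue integrable map. Standing assumption: the pushforward $\nu(A)=(\mu_x\otimes\mu_u)(F^{-1}(A))$ satisfies $\nu\ll\mu_x$ with $d\nu/d\mu_x\in L^\infty(X,\mu_x)$ (so that $\varphi\mapsto\varphi\circ F$ is a bounded linear operator $\mathcal{H}_x\to\mathcal{H}$). A sequence $\{\varphi_i\}$ in a Hilbert space is a Riesz basis if it is complete (closed span is the whole space) and there are $0<\alpha\le\beta<\infty$ with $\alpha\sum|c_i|^2\le\|\sum c_i\varphi_i\|^2\le\beta\sum|c_i|^2$ for all $(c_i)\in\ell^2$. Notation: $\Psi_x(x)=(\psi_{1,x}(x),\psi_{2,x}(x),\ldots)^\top$, $\Psi_u(u)=(\psi_{1,u}(u),\psi_{2,u}(u),\ldots)^\top$, and $\Psi(x,u)=\Psi_x(x)\otimes\Psi_u(u)=(\psi_1(x,u),\psi_2(x,u),\ldots)^\top$. $R^{-1}$ is the matrix of the inverse of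 $R$ as an operator on $\ell^2$. The identity is understood row by row: for every $i$, $\psi_{i,x}\circ F=\sum_k[\mathcal{K}]_{ik}\psi_k$ with convergence in $\mathcal{H}$. *)

(* Defs.v *)
From HB Require Import structures.
From mathcomp Require Import all_boot all_order all_algebra.
From mathcomp Require Import all_classical all_reals all_analysis.
From mathcomp Require Import measurable_realfun complex.

Set Implicit Arguments.
Unset Strict Implicit.
Unset Printing Implicit Defensive.

Import Order.TTheory GRing.Theory Num.Theory.
Import numFieldNormedType.Exports.

Local Open Scope classical_set_scope.
Local Open Scope ring_scope.

Variant scalar_kind := RealScalars | ComplexScalars.

(* The field K, which is R or C = R[i]. *)
Definition scalar_field (R : realType) (k : scalar_kind) : numFieldType :=
  match k return numFieldType with
  | RealScalars => R
  | ComplexScalars => R[i]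
  end.

Section scalars.
Context {R : realType} {k : scalar_kind}.

Definition scalar_re : scalar_field R k -> R :=
  match k return scalar_field R k -> R with
  | RealScalars => fun z => z
  | ComplexScalars => fun z => complex.Re z
  end.

Definition scalar_im : scalar_field R k -> R :=
  match k return scalar_field R k -> R with
  | RealScalars => fun=> 0
  | ComplexScalars => fun z => complex.Im z
  end.

Definition scalar_conj : scalar_field R k -> scalar_field R k :=
  match k return scalar_field R k -> scalar_field R k with
  | RealScalars => fun z => z
  | ComplexScalars => fun z => conjc z
  end.

(* The scalar a + ib; for K = R only the case b = 0 is meaningful. *)
Definition scalar_of : R -> R -> scalar_field R k :=
  match k return R -> R -> scalar_field R k with
  | RealScalars => fun a _ => a
  | ComplexScalars => fun a b => Complex a b
  end.

(* The norm of a numFieldType takes its values in the field itself: for K = C,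
   `|z| is the complex number |z| + 0i. *)
Definition scalar_abs (z : scalar_field R k) : R := scalar_re `|z|.

End scalars.

(* Elements of L^2(T, mu; K) are represented by functions T -> K; two functions
   at L^2 distance 0 represent the same element. *)
Section L2.
Context {R : realType} {k : scalar_kind}.
Context {d : measure_display} {T : measurableType d}.
Variable mu : {measure set T -> \bar R}.
Local Notation K := (scalar_field R k).

Definition L2norm (f : T -> K) : \bar R :=
  ('N[mu]_2%:E[EFin \o (scalar_abs \o f)])%E.

Definition L2 (f : T -> K) : Prop :=
  [/\ measurable_fun [set: T] (fun x => scalar_re (f x)),
      measurable_fun [set: T] (fun x => scalar_im (f x)) &
      (L2norm f < +oo)%E].

Definition L2inner (f g : T -> K) : K :=
  scalar_of (\int[mu]_x scalar_re (f x * scalar_conj (g x)))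
            (\int[mu]_x scalar_im (f x * scalar_conj (g x))).

(* f = \sum_i c_i phi_i in L^2(T, mu). *)
Definition L2_series (c : nat -> K) (phi : nat -> T -> K) (f : T -> K) : Prop :=
  L2norm (fun x => f x - \sum_(i < N) c i * phi i x) @[N --> \oo] --> 0%E.

Definition L2_complete (phi : nat -> T -> K) : Prop :=
  forall f : T -> K, L2 f -> forall e : R, 0 < e ->
  exists (N : nat) (c : nat -> K),
    (L2norm (fun x => f x - \sum_(i < N) c i * phi i x)%R < e%:E)%E.

Definition L2_free (phi : nat -> T -> K) : Prop :=
  forall (N : nat) (c : nat -> K),
  L2norm (fun x => \sum_(i < N) c i * phi i x) = 0%E ->
  forall i : nat, (i < N)%N -> c i = 0.

End L2.

Section l2.
Context {R : realType} {k : scalar_kind}.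
Local Notation K := (scalar_field R k).

Definition l2sqnorm (c : nat -> K) : \bar R :=
  (\sum_(0 <= i <oo) (scalar_abs (c i) ^+ 2)%R%:E)%E.

Definition l2 (c : nat -> K) : Prop := (l2sqnorm c < +oo)%E.

Definition dot_series (a b : nat -> K) (s : K) : Prop :=
  (\sum_(j < N) a j * b j) @[N --> \oo] --> s.

(* b = M a. *)
Definition mx_acts (M : nat -> nat -> K) (a b : nat -> K) : Prop :=
  forall i : nat, dot_series (M i) a (b i).

Definition l2_operator (M : nat -> nat -> K) : Prop :=
  exists C : R, forall a : nat -> K, l2 a ->
  exists b : nat -> K,
    [/\ l2 b, mx_acts M a b & (l2sqnorm b <= C%:E * l2sqnorm a)%E].

(* Minv is the matrix of the inverse of M as an operator on l^2: the two graphs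
   in l^2 x l^2 are transposes of each other. *)
Definition l2_inverse (M Minv : nat -> nat -> K) : Prop :=
  [/\ l2_operator M, l2_operator Minv &
      forall a b : nat -> K, l2 a -> l2 b -> (mx_acts M a b <-> mx_acts Minv b a)].

(* P = A B. *)
Definition mx_prod (A B P : nat -> nat -> K) : Prop :=
  forall i j : nat, dot_series (A i) (fun l => B l j) (P i j).

End l2.

Section Riesz.
Context {R : realType} {k : scalar_kind}.
Context {d : measure_display} {T : measurableType d}.
Variable mu : {measure set T -> \bar R}.
Local Notation K := (scalar_field R k).

(* The convergence of \sum_i c_i phi_i for c in l^2, implicit in the two-sided
   bound, is made explicit. *)
Definition L2_Riesz_basis (phi : nat -> T -> K) : Prop :=
  [/\ forall i : nat, L2 mu (phi i),
      L2_complete mu phi &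
      exists alpha beta : R, [/\ 0 < alpha, alpha <= beta &
        forall c : nat -> K, l2 c ->
        exists f : T -> K, [/\ L2 mu f, L2_series mu c phi f &
          (alpha%:E * l2sqnorm c <= L2norm mu f ^+ 2 <= beta%:E * l2sqnorm c)%E]]].

End Riesz.

(* nu << mu, with a Radon-Nikodym derivative g = d nu / d mu in L^oo(mu); the
   library's derivative is only available for finite nu. *)
Definition has_bounded_density {R : realType} {d : measure_display}
    {T : measurableType d} (nu : set T -> \bar R)
    (mu : {measure set T -> \bar R}) : Prop :=
  nu `<< mu /\
  exists g : T -> \bar R,
    [/\ measurable_fun [set: T] g,
        forall x : T, (0 <= g x)%E,
        forall A : set T, measurable A -> nu A = (\int[mu]_(x in A) g x)%E &
        ('N[mu]_+oo%E[g] < +oo)%E].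

(* Integrability of an R^n-valued map is integrability of its coordinates. *)
Definition vector_integrable {R : realType} {d : measure_display}
    {T : measurableType d} (mu : {measure set T -> \bar R})
    (n : nat) (h : T -> 'rV[R]_n) : Prop :=
  forall j : 'I_n, mu.-integrable [set: T] (fun z => (h z ord0 j)%:E).

(* Main.v *)
Require Import Defs.
From mathcomp Require Import all_boot all_order all_algebra.
From mathcomp Require Import all_classical all_reals all_analysis.
From mathcomp Require Import measurable_realfun complex.
From mathcomp Require Import ring lra.

Set Implicit Arguments.
Unset Strict Implicit.
Unset Printing Implicit Defensive.

Import Order.TTheory GRing.Theory Num.Theory.
Import numFieldNormedType.Exports.

Local Open Scope classical_set_scope.
Local Open Scope ring_scope.

(** The products psi_l form a Riesz basis of L^2(X x U), and the matrix
    identity is the expansion of psi_{i,x} o F in that basis, whose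
    coefficients are computed by the inverse of the Gram matrix R of the
    psi_l.

    Expansion. Suppose that alpha |c|^2 <= |sum_i c_i psi_i|^2 <= beta |c|^2
    for all finitely supported c and that the psi_l are complete. Write c R
    for the row of the limits of <sum_{i < N} c_i psi_i, psi_j>. The upper
    bound makes R bounded on l^2 ([Bessel], [Gram_row_exists]). The lower
    bound makes it onto: the combinations of psi_0, ..., psi_{n-1} with
    prescribed inner products b_0, ..., b_{n-1} come from inverting a finite
    Gram matrix, and they converge because they are projections of each
    other ([finite_section], [Gram_row_onto]). Associativity (c R) a = c (R
    a), which is [Gram_associative], then gives by duality the bound |c| <=
    |c R| / alpha, which is [Gram_row_bounded_below], and shows that the
    rows r_j with r_j R = e_j form a two-sided inverse of R. If c R = (<f,
    psi_j>)_j, then f = sum_i c_i psi_i ([Riesz_expansion]): f is close to a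
    finite combination g by completeness, and the coefficients of g and c
    are close by the bound just mentioned. Finally c = (c R) R^-1, which for
    f = psi_{i,x} o F is row i of K = Q R^-1 ([Gram_inverse_expansion]).

    Products. Let the phi_i and the chi_j be Riesz bases of L^2(X) and
    L^2(U), so that the psi_l are the products phi_i chi_j. For fixed x, a
    finite sum of c_ij phi_i(x) chi_j is a finite combination of the chi_j;
    the Riesz inequality of the chi_j, integrated over x by Tonelli's
    theorem, followed by that of the phi_i, gives the Riesz inequality of
    the products ([sqint_mixed_sum], [product_Riesz_system]). For
    completeness, project each slice f(x, .) onto the span of chi_0, ...,
    chi_{n-1}: the error tends to 0 in L^2(X x U) by dominated convergence
    ([slice_projection_cvg]), and the coefficients of the projection are
    functions in L^2(X), which finite combinations of the phi_i approximate
    ([product_complete]). *)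

(** * The scalar field *)

(** The field K is one of two concrete fields; these facts treat both alike. *)
Section scalar_theory.
Context {R : realType} {k : scalar_kind}.
Local Notation K := (scalar_field R k).
Implicit Types (x y z : K) (r s : R).

Definition scalar_emb r : K := scalar_of r 0.

Lemma scalar_reD x y : scalar_re (x + y) = scalar_re x + scalar_re y.
Proof. by case: k x y => //= -[a b] [c d]. Qed.

Lemma scalar_imD x y : scalar_im (x + y) = scalar_im x + scalar_im y.
Proof. by case: k x y => /= [x y|[a b] [c d]//]; rewrite addr0. Qed.

Lemma scalar_reN x : scalar_re (- x) = - scalar_re x.
Proof. by case: k x => //= -[]. Qed.

Lemma scalar_imN x : scalar_im (- x) = - scalar_im x.
Proof. by case: k x => /= [x|[]//]; rewrite oppr0. Qed.

Lemma scalar_re0 : scalar_re (0 : K) = 0.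
Proof. by case: k. Qed.

Lemma scalar_im0 : scalar_im (0 : K) = 0.
Proof. by case: k. Qed.

Lemma scalar_re_sum I (s : seq I) (P : pred I) (f : I -> K) :
  scalar_re (\sum_(i <- s | P i) f i) = \sum_(i <- s | P i) scalar_re (f i).
Proof. exact: (big_morph _ scalar_reD scalar_re0). Qed.

Lemma scalar_reM x y :
  scalar_re (x * y) = scalar_re x * scalar_re y - scalar_im x * scalar_im y.
Proof. by case: k x y => /= [x y|[a b] [c d]//]; rewrite mul0r subr0. Qed.

Lemma scalar_imM x y :
  scalar_im (x * y) = scalar_re x * scalar_im y + scalar_im x * scalar_re y.
Proof. by case: k x y => /= [x y|[a b] [c d]//]; rewrite mul0r mulr0 addr0. Qed.

Lemma scalar_reJ x : scalar_re (scalar_conj x) = scalar_re x.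
Proof. by case: k x => //= -[]. Qed.

Lemma scalar_imJ x : scalar_im (scalar_conj x) = - scalar_im x.
Proof. by case: k x => /= [x|[]//]; rewrite oppr0. Qed.

Lemma scalar_ext x y :
  scalar_re x = scalar_re y -> scalar_im x = scalar_im y -> x = y.
Proof. by case: k x y => //= -[a b] [c d] /= -> ->. Qed.

Lemma scalar_re_of r s : scalar_re (scalar_of r s : K) = r.
Proof. by case: k. Qed.

Lemma scalar_im_of r s : scalar_im (scalar_of r s : K) =
  if k is ComplexScalars then s else 0.
Proof. by case: k. Qed.

Lemma scalar_im_emb r : scalar_im (scalar_emb r) = 0.
Proof. by rewrite scalar_im_of; case: k. Qed.

Lemma scalar_conjK : involutive (scalar_conj : K -> K).
Proof. by case: k => //= x; rewrite conjcK. Qed.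

Lemma scalar_conjD x y : scalar_conj (x + y) = scalar_conj x + scalar_conj y.
Proof. by case: k x y => //= x y; exact: rmorphD. Qed.

Lemma scalar_conjN x : scalar_conj (- x) = - scalar_conj x.
Proof. by case: k x => //= x; exact: rmorphN. Qed.

Lemma scalar_conjM x y : scalar_conj (x * y) = scalar_conj x * scalar_conj y.
Proof. by case: k x y => //= x y; exact: rmorphM. Qed.

Lemma scalar_conj0 : scalar_conj 0 = 0 :> K.
Proof. by apply: (addIr (scalar_conj (0 : K))); rewrite -scalar_conjD !add0r. Qed.

Lemma scalar_conj_sum I (s : seq I) (P : pred I) (f : I -> K) :
  scalar_conj (\sum_(i <- s | P i) f i) =
  \sum_(i <- s | P i) scalar_conj (f i).
Proof. exact: (big_morph _ scalar_conjD scalar_conj0). Qed.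

Lemma scalar_sqabs x :
  scalar_abs x ^+ 2 = scalar_re x ^+ 2 + scalar_im x ^+ 2.
Proof.
rewrite /scalar_abs; case: k x => /= [x|[a b]].
  by rewrite real_normK ?num_real// expr0n addr0.
by rewrite sqr_sqrtr// addr_ge0 ?sqr_ge0.
Qed.

Lemma scalar_norm x : `|x| = scalar_emb (scalar_abs x).
Proof. by rewrite /scalar_abs /scalar_emb; case: k x => //= -[]. Qed.

Lemma scalar_abs_ge0 x : 0 <= scalar_abs x.
Proof. by rewrite /scalar_abs; case: k x => //= -[a b]; exact: sqrtr_ge0. Qed.

Lemma scalar_mulJ x : x * scalar_conj x = scalar_emb (scalar_abs x ^+ 2).
Proof.
rewrite scalar_sqabs; apply: scalar_ext; last first.
  by rewrite scalar_im_emb scalar_imM scalar_reJ scalar_imJ; ring.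
by rewrite scalar_re_of scalar_reM scalar_reJ scalar_imJ; ring.
Qed.

Lemma scalar_absM x y : scalar_abs (x * y) = scalar_abs x * scalar_abs y.
Proof.
apply/eqP; rewrite -(@eqrXn2 _ 2) ?mulr_ge0 ?scalar_abs_ge0//; apply/eqP.
by rewrite exprMn !scalar_sqabs scalar_reM scalar_imM; ring.
Qed.

Lemma scalar_absJ x : scalar_abs (scalar_conj x) = scalar_abs x.
Proof.
apply/eqP; rewrite -(@eqrXn2 _ 2) ?scalar_abs_ge0//; apply/eqP.
by rewrite !scalar_sqabs scalar_reJ scalar_imJ sqrrN.
Qed.

Lemma scalar_absN x : scalar_abs (- x) = scalar_abs x.
Proof. by rewrite /scalar_abs normrN. Qed.

Lemma scalar_abs0 : scalar_abs (0 : K) = 0.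
Proof. by rewrite /scalar_abs normr0 scalar_re0. Qed.

Lemma scalar_abs_emb r : 0 <= r -> scalar_abs (scalar_emb r) = r.
Proof.
move=> r0; apply/eqP; rewrite -(@eqrXn2 _ 2) ?scalar_abs_ge0//; apply/eqP.
by rewrite scalar_sqabs scalar_im_emb scalar_re_of expr0n addr0.
Qed.

Lemma scalar_lt_emb r s : (scalar_emb r < scalar_emb s) = (r < s).
Proof. by rewrite /scalar_emb; case: k => //=; rewrite ltcR. Qed.

(** In the partial order of R[i], a positive number is real. *)
Lemma scalar_gt0_emb x : 0 < x -> x = scalar_emb (scalar_re x).
Proof.
rewrite /scalar_emb; case: k x => //= -[a b].
by rewrite ltcE /= => /andP[/eqP -> _].
Qed.

Lemma scalar_re_le x y : x <= y -> scalar_re x <= scalar_re y.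
Proof. by case: k x y => //= x y; rewrite lecE => /andP[]. Qed.

Lemma scalar_absD x y : scalar_abs (x + y) <= scalar_abs x + scalar_abs y.
Proof. by rewrite /scalar_abs -scalar_reD scalar_re_le// ler_normD. Qed.

Lemma scalar_abs_eq0 x : scalar_abs x = 0 -> x = 0.
Proof.
move=> x0; have := scalar_sqabs x; rewrite x0 expr0n/= => /esym/eqP.
rewrite paddr_eq0 ?sqr_ge0// !sqrf_eq0 => /andP[/eqP re0 /eqP im0].
by apply: scalar_ext; rewrite ?scalar_re0 ?scalar_im0.
Qed.

Lemma scalar_re_le_abs x : `|scalar_re x| <= scalar_abs x.
Proof.
rewrite -(@ler_pXn2r _ 2) ?nnegrE ?scalar_abs_ge0// real_normK ?num_real//.
by rewrite scalar_sqabs lerDl sqr_ge0.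
Qed.

Lemma scalar_im_le_abs x : `|scalar_im x| <= scalar_abs x.
Proof.
rewrite -(@ler_pXn2r _ 2) ?nnegrE ?scalar_abs_ge0// real_normK ?num_real//.
by rewrite scalar_sqabs lerDr sqr_ge0.
Qed.

Lemma scalar_abs_le_reim x : scalar_abs x <= `|scalar_re x| + `|scalar_im x|.
Proof.
rewrite -(@ler_pXn2r _ 2) ?nnegrE ?scalar_abs_ge0 ?addr_ge0//.
rewrite scalar_sqabs -(real_normK (num_real (scalar_re x))).
rewrite -(real_normK (num_real (scalar_im x))).
by rewrite sqrrD -addrA lerD2l lerDr mulrn_wge0// mulr_ge0.
Qed.

(** The parallelogram identity, with one term dropped. *)
Lemma scalar_sqabsD x y :
  scalar_abs (x + y) ^+ 2 <= 2 * (scalar_abs x ^+ 2 + scalar_abs y ^+ 2).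
Proof.
rewrite !scalar_sqabs scalar_reD scalar_imD -subr_ge0.
set a := scalar_re x; set b := scalar_re y.
set c := scalar_im x; set d := scalar_im y.
have -> : 2 * (a ^+ 2 + c ^+ 2 + (b ^+ 2 + d ^+ 2)) -
   ((a + b) ^+ 2 + (c + d) ^+ 2) = (a - b) ^+ 2 + (c - d) ^+ 2 by ring.
by rewrite addr_ge0 ?sqr_ge0.
Qed.

(** The neighbourhoods in K are defined by radii that are positive elements of
    K; real radii suffice. *)
Lemma cvg_scalarP (u : nat -> K) (l : K) :
  (u @ \oo --> l) <->
  (forall e : R, 0 < e -> \forall n \near \oo, scalar_abs (u n - l) < e).
Proof.
split=> [/cvgrPdist_lt ul e e0|ul].
  have := ul (scalar_emb e); rewrite -{1}[0](_ : scalar_emb 0 = 0); last first.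
    by rewrite /scalar_emb; case: k.
  rewrite scalar_lt_emb => /(_ e0); apply: filterS => n.
  by rewrite scalar_norm scalar_lt_emb -scalar_absN opprB.
apply/cvgrPdist_lt => e e0; rewrite (scalar_gt0_emb e0).
have re0 : 0 < scalar_re e.
  rewrite -scalar_lt_emb -(scalar_gt0_emb e0).
  by rewrite [scalar_emb 0](_ : _ = 0)// /scalar_emb; case: k {e0}.
apply: filterS (ul _ re0) => n.
by rewrite scalar_norm scalar_lt_emb -scalar_absN opprB.
Qed.

(** Real and imaginary parts are Cauchy sequences of real numbers. *)
Lemma scalar_cauchy_cvg (u : nat -> K) :
  (forall e : R, 0 < e -> exists N, forall m n, (N <= m)%N -> (N <= n)%N ->
    scalar_abs (u m - u n) < e) ->
  exists l : K, u @ \oo --> l.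
Proof.
move=> uc.
have cvg_part (p : K -> R) : (forall x y, `|p x - p y| <= scalar_abs (x - y)) ->
    cvgn (p \o u).
  move=> pu; apply: cauchy_cvg; apply/cauchy_exP => e e0.
  have [N uN] := uc _ e0.
  exists (p (u N)); exists N => // n /= Nn.
  by rewrite /ball /=; apply: (le_lt_trans (pu _ _)); exact: uN.
have /cvg_ex[a /= ua] : cvgn (scalar_re \o u).
  apply: cvg_part => x y; rewrite -scalar_reN -scalar_reD.
  exact: scalar_re_le_abs.
have /cvg_ex[b /= ub] : cvgn (scalar_im \o u).
  apply: cvg_part => x y; rewrite -scalar_imN -scalar_imD.
  exact: scalar_im_le_abs.
exists (scalar_of a b); apply/cvg_scalarP => e e0.
move/cvgrPdist_lt : ua => /(_ (e / 2)); rewrite divr_gt0// => /(_ isT) ua.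
move/cvgrPdist_lt : ub => /(_ (e / 2)); rewrite divr_gt0// => /(_ isT) ub.
have imB (x : K) :
    `|scalar_im x - scalar_im (scalar_of a b : K)| <= `|b - scalar_im x|.
  rewrite scalar_im_of; case: k x => /= [x|x]; last by rewrite distrC.
  by rewrite subrr normr0.
near=> n; rewrite (le_lt_trans (scalar_abs_le_reim _))// (splitr e) ltrD//.
  rewrite scalar_reD scalar_reN scalar_re_of distrC.
  by near: n.
rewrite scalar_imD scalar_imN (le_lt_trans (imB _))//.
by near: n.
Unshelve. all: by end_near. Qed.

End scalar_theory.

(** * The semi-inner product of L^2 *)

Section scalar_measurability.
Context {R : realType} {k : scalar_kind}.
Context {d : measure_display} {T : measurableType d}.
Local Notation K := (scalar_field R k).
Implicit Types f g : T -> K.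

Definition scalar_measurable f :=
  measurable_fun [set: T] (fun x => scalar_re (f x)) /\
  measurable_fun [set: T] (fun x => scalar_im (f x)).

Lemma scalar_measurableD f g : scalar_measurable f -> scalar_measurable g ->
  scalar_measurable (fun x => f x + g x).
Proof.
move=> [fr fi] [gr gi]; split.
  by under eq_fun do rewrite scalar_reD; exact: measurable_funD.
by under eq_fun do rewrite scalar_imD; exact: measurable_funD.
Qed.

Lemma scalar_measurableM f g : scalar_measurable f -> scalar_measurable g ->
  scalar_measurable (fun x => f x * g x).
Proof.
move=> [fr fi] [gr gi]; split.
  under eq_fun do rewrite scalar_reM.
  by apply: measurable_funB; exact: measurable_funM.
under eq_fun do rewrite scalar_imM.
by apply: measurable_funD; exact: measurable_funM.
Qed.

Lemma scalar_measurableB f g : scalar_measurable f -> scalar_measurable g ->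
  scalar_measurable (fun x => f x - g x).
Proof.
move=> [fr fi] [gr gi]; split.
  under eq_fun do rewrite scalar_reD scalar_reN.
  exact: measurable_funB.
under eq_fun do rewrite scalar_imD scalar_imN.
exact: measurable_funB.
Qed.

Lemma scalar_measurable_cst (c : K) : scalar_measurable (fun=> c).
Proof. by split; exact: measurable_cst. Qed.

Lemma scalar_measurableZ (c : K) f :
  scalar_measurable f -> scalar_measurable (fun x => c * f x).
Proof. by move=> ?; apply: scalar_measurableM => //; exact: scalar_measurable_cst. Qed.

Lemma scalar_measurable_sum n (f : nat -> T -> K) :
  (forall i, scalar_measurable (f i)) ->
  scalar_measurable (fun x => \sum_(i < n) f i x).
Proof.
move=> mf; elim: n => [|n ih].
  by under eq_fun do rewrite big_ord0; exact: scalar_measurable_cst.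
by under eq_fun do rewrite big_ord_recr/=; exact: scalar_measurableD.
Qed.

Lemma scalar_measurableJ f :
  scalar_measurable f -> scalar_measurable (fun x => scalar_conj (f x)).
Proof.
move=> [fr fi]; split.
  by under eq_fun do rewrite scalar_reJ.
by under eq_fun do rewrite scalar_imJ; exact: measurable_funN.
Qed.

Lemma measurable_sqabs f : scalar_measurable f ->
  measurable_fun [set: T] (fun x => scalar_abs (f x) ^+ 2).
Proof.
move=> [fr fi]; under eq_fun do rewrite scalar_sqabs.
by apply: measurable_funD; exact: measurable_funX.
Qed.

Lemma measurable_sqabsE f : scalar_measurable f ->
  measurable_fun [set: T] (fun x => (scalar_abs (f x) ^+ 2)%:E).
Proof. by move=> mf; apply/measurable_EFinP; exact: measurable_sqabs. Qed.

End scalar_measurability.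

Section L2_theory.
Context {R : realType} {k : scalar_kind}.
Context {d : measure_display} {T : measurableType d}.
Variable mu : {measure set T -> \bar R}.
Local Notation K := (scalar_field R k).
Implicit Types f g h : T -> K.

(** The square of the L^2 norm, infinite outside L^2. Squares satisfy the
    elementary |a + b|^2 <= 2 (|a|^2 + |b|^2), and Tonelli's theorem relates
    them to the slices of a function on a product. *)
Definition sqint f : \bar R := (\int[mu]_x (scalar_abs (f x) ^+ 2)%:E)%E.


Definition L2sq f : R := fine (sqint f).

Local Notation ip := (L2inner mu).

Lemma sqint_ge0 f : (0 <= sqint f)%E.
Proof. by apply: integral_ge0 => x _; rewrite lee_fin sqr_ge0. Qed.

Lemma L2norm_ge0 f : (0 <= L2norm mu f)%E.
Proof. exact: Lnorm_ge0. Qed.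

Lemma sqint_sqr_L2norm f : sqint f = (L2norm mu f ^+ 2)%E.
Proof.
transitivity (L2norm mu f `^ 2)%E.
  rewrite /L2norm poweR_Lnorm// /sqint; apply: eq_integral => x _ /=.
  by rewrite powR_mulrn// ger0_norm ?scalar_abs_ge0.
have := L2norm_ge0 f; case: (L2norm mu f) => [r|_|//].
  by rewrite lee_fin poweR_EFin -EFin_expe => r0; rewrite powR_mulrn.
by rewrite poweRyr// expe2 mulyy.
Qed.

Lemma L2norm_ltE f (e : R) : 0 < e ->
  (L2norm mu f < e%:E)%E = (sqint f < (e ^+ 2)%:E)%E.
Proof.
rewrite sqint_sqr_L2norm => e0.
have := L2norm_ge0 f; case: (L2norm mu f) => [r|_|//].
  rewrite lee_fin -EFin_expe !lte_fin => r0.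
  by rewrite ltr_pXn2r// nnegrE ltW.
by rewrite expe2 mulyy !ltNge !leey.
Qed.

Lemma L2norm_ltyE f : (L2norm mu f < +oo)%E = (sqint f < +oo)%E.
Proof.
rewrite sqint_sqr_L2norm; have := L2norm_ge0 f.
case: (L2norm mu f) => [r|_|//]; first by rewrite -EFin_expe !ltry.
by rewrite expe2 mulyy.
Qed.

Lemma L2P f : L2 mu f <-> scalar_measurable f /\ (sqint f < +oo)%E.
Proof.
by rewrite /L2 L2norm_ltyE; split=> [[? ? ?]|[[? ?] ?]].
Qed.

Lemma L2_measurable f : L2 mu f -> scalar_measurable f.
Proof. by move/L2P => -[]. Qed.

Lemma L2_sqint f : L2 mu f -> sqint f = (L2sq f)%:E.
Proof.
by move=> /L2P[_ fy]; rewrite fineK// ge0_fin_numE// sqint_ge0.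
Qed.

Lemma cvg_L2normP (u : nat -> T -> K) :
  (forall e : R, 0 < e -> \forall n \near \oo, (sqint (u n) <= e%:E)%E) <->
  (L2norm mu (u n) @[n --> \oo] --> 0%E).
Proof.
split=> [ucv|].
  have small (e : R) : 0 < e -> \forall n \near \oo, (L2norm mu (u n) < e%:E)%E.
    move=> e0; have e20 : 0 < e ^+ 2 / 2 by rewrite divr_gt0// exprn_gt0.
    apply: filterS (ucv _ e20) => n un; rewrite L2norm_ltE//.
    rewrite (le_lt_trans un)// lte_fin ltr_pdivrMr// ltr_pMr ?exprn_gt0//.
    by rewrite ltr1n.
  apply/fine_cvgP; split.
    apply: filterS (small 1 ltr01) => n un.
    by rewrite ge0_fin_numE ?L2norm_ge0// (lt_trans un) ?ltry.
  apply/cvgrPdist_lt => e e0; apply: filterS (small e e0) => n un /=.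
  rewrite sub0r normrN ger0_norm ?fine_ge0 ?L2norm_ge0//.
  rewrite -lte_fin fineK// ge0_fin_numE ?L2norm_ge0//.
  by rewrite (lt_trans un) ?ltry.
move=> /fine_cvgP[ufin /cvgrPdist_lt ucv] e e0.
have se0 : 0 < Num.sqrt e by rewrite sqrtr_gt0.
move: (ucv _ se0) => {}ucv; near=> n.
have un : (L2norm mu (u n) < (Num.sqrt e)%:E)%E.
  rewrite -(@fineK _ (L2norm mu (u n))); last by near: n.
  rewrite lte_fin -[ltLHS]ger0_norm ?fine_ge0 ?L2norm_ge0//.
  rewrite -[ltLHS]normrN -[X in `|X|]add0r; near: n.
  exact: ucv.
by move: un; rewrite L2norm_ltE// sqr_sqrtr ?(ltW e0)// => /ltW.
Unshelve. all: by end_near. Qed.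

Lemma sqintZ (c : K) f : scalar_measurable f ->
  sqint (fun x => c * f x)%R = ((scalar_abs c ^+ 2)%:E * sqint f)%E.
Proof.
move=> mf; rewrite /sqint -ge0_integralZl_EFin//.
- by apply: eq_integral => x _; rewrite scalar_absM exprMn EFinM.
- by move=> x _; rewrite lee_fin sqr_ge0.
- exact: measurable_sqabsE.
- exact: sqr_ge0.
Qed.

Lemma sqintD f g : scalar_measurable f -> scalar_measurable g ->
  (sqint (fun x => f x + g x)%R <= 2%:E * (sqint f + sqint g))%E.
Proof.
move=> mf mg; rewrite /sqint -ge0_integralD//; last 4 first.
- by move=> x _; rewrite lee_fin sqr_ge0.
- exact: measurable_sqabsE.
- by move=> x _; rewrite lee_fin sqr_ge0.
- exact: measurable_sqabsE.
rewrite -ge0_integralZl_EFin//; last 2 first.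
- by move=> x _; rewrite adde_ge0// lee_fin sqr_ge0.
- by apply: emeasurable_funD; exact: measurable_sqabsE.
apply: ge0_le_integral => //.
- by move=> x _; rewrite lee_fin sqr_ge0.
- by apply: measurable_sqabsE; exact: scalar_measurableD.
- apply: measurable_funeM.
  by apply: emeasurable_funD; exact: measurable_sqabsE.
- by move=> x _; rewrite -EFinD -EFinM lee_fin; exact: scalar_sqabsD.
Qed.

Lemma L2D f g : L2 mu f -> L2 mu g -> L2 mu (fun x => f x + g x).
Proof.
move=> /L2P[mf fy] /L2P[mg gy]; apply/L2P; split; first exact: scalar_measurableD.
apply: le_lt_trans (sqintD mf mg) _.
by rewrite lte_mul_pinfty// lte_add_pinfty.
Qed.

Lemma L2Z (c : K) f : L2 mu f -> L2 mu (fun x => c * f x).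
Proof.
move=> /L2P[mf fy]; apply/L2P; split; first exact: scalar_measurableZ.
by rewrite sqintZ// lte_mul_pinfty// lee_fin sqr_ge0.
Qed.

Lemma L2B f g : L2 mu f -> L2 mu g -> L2 mu (fun x => f x - g x).
Proof.
move=> f2 g2; rewrite [X in L2 _ X](_ : _ = fun x => f x + (-1) * g x).
  by apply: L2D => //; exact: L2Z.
by apply/funext => x; rewrite mulN1r.
Qed.

Lemma L20 : L2 mu (fun=> 0 : K).
Proof.
apply/L2P; split; first exact: scalar_measurable_cst.
by rewrite /sqint scalar_abs0 expr0n/= integral0.
Qed.

Lemma L2_sum n (f : nat -> T -> K) : (forall i, L2 mu (f i)) ->
  L2 mu (fun x => \sum_(i < n) f i x).
Proof.
move=> f2; elim: n => [|n ih].
  by under eq_fun do rewrite big_ord0; exact: L20.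
by under eq_fun do rewrite big_ord_recr/=; exact: L2D.
Qed.

(** By |f g| <= |f|^2 + |g|^2. *)
Lemma L2_integrable_mulJ f g : L2 mu f -> L2 mu g ->
  mu.-integrable [set: T] (EFin \o (fun x => scalar_re (f x * scalar_conj (g x)))) /\
  mu.-integrable [set: T] (EFin \o (fun x => scalar_im (f x * scalar_conj (g x)))).
Proof.
move=> /L2P[mf fy] /L2P[mg gy].
have [mr mi] := scalar_measurableM mf (scalar_measurableJ mg).
have dom x : scalar_abs (f x * scalar_conj (g x)) <=
    `|scalar_abs (f x) ^+ 2 + scalar_abs (g x) ^+ 2|.
  rewrite scalar_absM scalar_absJ ger0_norm ?addr_ge0 ?sqr_ge0//.
  rewrite -subr_ge0 (_ : _ - _ = (scalar_abs (f x) - scalar_abs (g x)) ^+ 2 +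
     scalar_abs (f x) * scalar_abs (g x)); last by ring.
  by rewrite addr_ge0 ?sqr_ge0// mulr_ge0 ?scalar_abs_ge0.
have ig : mu.-integrable [set: T]
    (fun x => (scalar_abs (f x) ^+ 2 + scalar_abs (g x) ^+ 2)%:E).
  under eq_fun do rewrite EFinD.
  apply: integrableD => //; apply/integrableP; split; try exact: measurable_sqabsE.
    by under eq_integral do rewrite gee0_abs ?lee_fin ?sqr_ge0//.
  by under eq_integral do rewrite gee0_abs ?lee_fin ?sqr_ge0//.
split; apply: (le_integrable _ _ _ ig) => //; try exact/measurable_EFinP.
  by move=> x _ /=; rewrite lee_fin (le_trans (scalar_re_le_abs _)).
by move=> x _ /=; rewrite lee_fin (le_trans (scalar_im_le_abs _)).
Qed.

Lemma scalar_re_ip f g :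
  scalar_re (ip f g) = \int[mu]_x scalar_re (f x * scalar_conj (g x)).
Proof. by rewrite scalar_re_of. Qed.

(** For K = R both sides vanish, since scalar_of drops its second argument. *)
Lemma scalar_im_ip f g :
  scalar_im (ip f g) = \int[mu]_x scalar_im (f x * scalar_conj (g x)).
Proof.
rewrite scalar_im_of; case: k f g => //= f g.
by rewrite /Rintegral integral0.
Qed.

Lemma ipDl f g h : L2 mu f -> L2 mu g -> L2 mu h ->
  ip (fun x => f x + g x) h = ip f h + ip g h.
Proof.
move=> f2 g2 h2.
have [fr fi] := L2_integrable_mulJ f2 h2.
have [gr gi] := L2_integrable_mulJ g2 h2.
apply: scalar_ext; rewrite ?(scalar_reD, scalar_imD, scalar_re_ip, scalar_im_ip).
  by rewrite -RintegralD//; apply: eq_Rintegral => x _; rewrite mulrDl scalar_reD.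
by rewrite -RintegralD//; apply: eq_Rintegral => x _; rewrite mulrDl scalar_imD.
Qed.

Lemma ipZl (c : K) f g : L2 mu f -> L2 mu g ->
  ip (fun x => c * f x) g = c * ip f g.
Proof.
move=> f2 g2; have [fr fi] := L2_integrable_mulJ f2 g2.
have iZ (a : R) (p : T -> R) : mu.-integrable [set: T] (EFin \o p) ->
    mu.-integrable [set: T] (EFin \o (fun x => a * p x)).
  by move=> ip; exact: (integrableZl _ a ip).
apply: scalar_ext; rewrite ?(scalar_reM, scalar_imM, scalar_re_ip, scalar_im_ip).
  rewrite -!RintegralZl// -RintegralB//; try exact: iZ.
  by apply: eq_Rintegral => x _; rewrite -mulrA scalar_reM.
rewrite -!RintegralZl// -RintegralD//; try exact: iZ.
by apply: eq_Rintegral => x _; rewrite -mulrA scalar_imM.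
Qed.

Lemma ipJ f g : L2 mu f -> L2 mu g -> ip g f = scalar_conj (ip f g).
Proof.
move=> f2 g2; have [fr fi] := L2_integrable_mulJ f2 g2.
apply: scalar_ext; rewrite ?(scalar_reJ, scalar_imJ, scalar_re_ip, scalar_im_ip).
  apply: eq_Rintegral => x _.
  by rewrite -scalar_reJ scalar_conjM scalar_conjK mulrC.
rewrite -mulN1r -RintegralZl//; apply: eq_Rintegral => x _.
by rewrite mulN1r -scalar_imJ scalar_conjM scalar_conjK mulrC.
Qed.

Lemma ipff f : ip f f = scalar_emb (L2sq f).
Proof.
apply: scalar_ext; rewrite ?(scalar_re_ip, scalar_im_ip, scalar_re_of, scalar_im_emb).
  by apply: eq_Rintegral => x _; rewrite scalar_mulJ scalar_re_of.
rewrite /Rintegral; under eq_integral do rewrite scalar_mulJ scalar_im_emb.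
by rewrite integral0.
Qed.

Lemma L2sqE f : L2sq f = scalar_re (ip f f).
Proof. by rewrite ipff scalar_re_of. Qed.

Lemma L2sq_ge0 f : 0 <= L2sq f.
Proof. by rewrite fine_ge0// sqint_ge0. Qed.

Lemma ipBl f g h : L2 mu f -> L2 mu g -> L2 mu h ->
  ip (fun x => f x - g x) h = ip f h - ip g h.
Proof.
move=> f2 g2 h2; rewrite -[in RHS]mulN1r -ipZl// -ipDl//; last exact: L2Z.
by congr (ip _ _); apply/funext => x; rewrite mulN1r.
Qed.

Lemma ip_suml n (c : nat -> K) (f : nat -> T -> K) g :
  (forall i, L2 mu (f i)) -> L2 mu g ->
  ip (fun x => \sum_(i < n) c i * f i x) g = \sum_(i < n) c i * ip (f i) g.
Proof.
move=> f2 g2; elim: n => [|n ih].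
  rewrite big_ord0 (_ : (fun _ => _) = (fun x => 0 * g x)); last first.
    by apply/funext => x; rewrite big_ord0 mul0r.
  by rewrite ipZl// mul0r.
rewrite big_ord_recr/= -ih -ipZl// -ipDl//; last exact: L2Z.
  by congr (ip _ _); apply/funext => x; rewrite big_ord_recr.
by apply: (@L2_sum n (fun i x => c i * f i x)) => i; exact: L2Z.
Qed.

Lemma ip_sumr n (c : nat -> K) (f : nat -> T -> K) g :
  (forall i, L2 mu (f i)) -> L2 mu g ->
  ip g (fun x => \sum_(i < n) c i * f i x) =
  \sum_(i < n) scalar_conj (c i) * ip g (f i).
Proof.
move=> f2 g2; rewrite ipJ//; last first.
  by apply: (@L2_sum n (fun i x => c i * f i x)) => i; exact: L2Z.
rewrite ip_suml// scalar_conj_sum; apply: eq_bigr => i _.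
by rewrite scalar_conjM -ipJ.
Qed.

Lemma ipBr f g h : L2 mu f -> L2 mu g -> L2 mu h ->
  ip h (fun x => f x - g x) = ip h f - ip h g.
Proof.
move=> f2 g2 h2; rewrite ipJ ?ipBl ?scalar_conjD ?scalar_conjN -?ipJ//.
exact: L2B.
Qed.

Lemma L2sqZ (c : K) f : L2 mu f ->
  L2sq (fun x => c * f x) = scalar_abs c ^+ 2 * L2sq f.
Proof.
by move=> f2; rewrite {1}/L2sq sqintZ ?L2_sqint//; exact: L2_measurable.
Qed.

Lemma L2sqB f g : L2 mu f -> L2 mu g ->
  L2sq (fun x => f x - g x) = L2sq f - 2 * scalar_re (ip f g) + L2sq g.
Proof.
move=> f2 g2; rewrite !L2sqE ipBl// ?ipBr//; last exact: L2B.
rewrite (ipJ f2 g2) !(scalar_reD, scalar_reN) scalar_reJ; ring.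
Qed.

Lemma ipZr (c : K) f g : L2 mu f -> L2 mu g ->
  ip f (fun x => c * g x) = scalar_conj c * ip f g.
Proof.
by move=> f2 g2; rewrite ipJ ?ipZl ?scalar_conjM -?ipJ//; exact: L2Z.
Qed.

(** Positivity of the squared distance between f and t <f, g> g, for every
    real t. *)
Lemma Cauchy_Schwarz f g : L2 mu f -> L2 mu g ->
  scalar_abs (ip f g) ^+ 2 <= L2sq f * L2sq g.
Proof.
move=> f2 g2; set P := scalar_abs (ip f g) ^+ 2.
have P0 : 0 <= P by exact: sqr_ge0.
have pos t : 0 <= L2sq f - 2 * t * P + t ^+ 2 * P * L2sq g.
  have := L2sq_ge0 (fun x => f x - (scalar_emb t * ip f g) * g x).
  rewrite L2sqB//; last exact: L2Z.
  rewrite L2sqZ//.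
  rewrite ipZr// /P !scalar_sqabs.
  rewrite !(scalar_reM, scalar_imM, scalar_reJ, scalar_imJ).
  rewrite scalar_re_of scalar_im_emb.
  set a := scalar_re _; set b := scalar_im _; lra.
have A0 := L2sq_ge0 f.
have := L2sq_ge0 g; rewrite le_eqVlt => /predU1P[G0|G0].
  move: pos; rewrite -G0 mulr0 => pos.
  rewrite leNgt; apply/negP => Pgt0.
  have := pos ((L2sq f + 1) / (2 * P)).
  rewrite mulr0 addr0 (_ : 2 * _ * P = L2sq f + 1); first by lra.
  by field; rewrite gt_eqF.
have /(ler_wpM2r (ltW G0)) := pos (L2sq g)^-1.
set X := (X in _ * _ <= X).
have -> : X = L2sq f * L2sq g - P by rewrite /X; field; rewrite gt_eqF.
by rewrite mul0r subr_ge0.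
Qed.

End L2_theory.
Arguments sqint {R k d T} mu f.

(** * Sums of squares and limits of scalars *)

Lemma nondecreasing_bounded_tail (R : realType) (u : nat -> R) (B : R) :
  {homo u : m n / (m <= n)%N >-> m <= n} -> (forall n, u n <= B) ->
  forall e : R, 0 < e ->
  exists M, forall m n, (M <= m)%N -> (m <= n)%N -> u n - u m <= e.
Proof.
move=> nd ub e e0.
have /cvgrPdist_le /(_ e e0) [M _ uM] : u @ \oo --> sup (range u).
  apply: nondecreasing_cvgn => //; exists B => _ [n _ <-]; exact: ub.
have us n : u n <= sup (range u).
  by apply: ub_le_sup; [exists B => _ [m _ <-]; exact: ub|exists n].
exists M => m n Mm mn; have := uM m Mm.
by rewrite ger0_norm ?subr_ge0// => /(le_trans _) -> //; rewrite lerD2r.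
Qed.

(** Partial sums of different lengths are compared by padding with zeros. *)
Lemma sum_truncate (V : nmodType) (F : nat -> V) (M N : nat) : (M <= N)%N ->
  \sum_(i < N) (if (i < M)%N then F i else 0) = \sum_(i < M) F i.
Proof. by move=> MN; rewrite (@big_ord_widen _ _ _ M N F)// [RHS]big_mkcond. Qed.

(** The l^2 norm is used only through the real partial sums of squares. *)
Section square_sums.
Context {R : realType} {k : scalar_kind}.
Local Notation K := (scalar_field R k).
Implicit Types (a b c : nat -> K) (B : R).

Definition sqsum N c : R := \sum_(i < N) scalar_abs (c i) ^+ 2.

Lemma sqsum_ge0 N c : 0 <= sqsum N c.
Proof. by apply: sumr_ge0 => i _; exact: sqr_ge0. Qed.

Lemma sqsum_homo c : {homo (sqsum ^~ c) : m n / (m <= n)%N >-> m <= n}.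
Proof.
apply: homo_leq => //; first exact: le_trans.
by move=> n; rewrite /sqsum big_ord_recr/= lerDl sqr_ge0.
Qed.

Lemma sqsum_ge_term i c : scalar_abs (c i) ^+ 2 <= sqsum i.+1 c.
Proof. by rewrite /sqsum big_ord_recr/= lerDr; exact: sqsum_ge0. Qed.

Lemma sqsumJ N c : sqsum N (scalar_conj \o c) = sqsum N c.
Proof. by apply: eq_bigr => i _ /=; rewrite scalar_absJ. Qed.

Lemma sqsum_head M N c : (M <= N)%N ->
  sqsum N (fun i => if (i < M)%N then c i else 0) = sqsum M c.
Proof.
move=> MN; rewrite -[RHS](sum_truncate (fun i => scalar_abs (c i) ^+ 2) MN).
by apply: eq_bigr => i _; case: ifP => // _; rewrite scalar_abs0 expr0n.
Qed.

Lemma sqsum_tail M N c : (M <= N)%N ->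
  sqsum N (fun i => if (i < M)%N then 0 else c i) = sqsum N c - sqsum M c.
Proof.
move=> MN; rewrite -(sqsum_head c MN) /sqsum -sumrB; apply: eq_bigr => i _.
by case: ifP => _; rewrite scalar_abs0 expr0n ?subrr ?subr0.
Qed.

Lemma l2sqnorm_le c B :
  (l2sqnorm c <= B%:E)%E <-> (forall N, sqsum N c <= B).
Proof.
have psumE N : (\sum_(0 <= i < N) (scalar_abs (c i) ^+ 2)%:E)%E = (sqsum N c)%:E.
  by rewrite sumEFin big_mkord.
split=> [cB N|cB].
  rewrite -lee_fin -psumE; apply: le_trans cB.
  by apply: nneseries_lim_ge => i _ _; rewrite lee_fin sqr_ge0.
apply: lime_le.
  by apply: is_cvg_nneseries => i _ _; rewrite lee_fin sqr_ge0.
by apply: nearW => N; rewrite psumE lee_fin.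
Qed.

Lemma l2sqnorm_ge0 c : (0 <= l2sqnorm c)%E.
Proof. by apply: nneseries_ge0 => i _ _; rewrite lee_fin sqr_ge0. Qed.

Lemma l2_fineK c : l2 c -> l2sqnorm c = (fine (l2sqnorm c))%:E.
Proof. by move=> c2; rewrite fineK// ge0_fin_numE// l2sqnorm_ge0. Qed.

Lemma l2_sqsum c : l2 c -> forall N, sqsum N c <= fine (l2sqnorm c).
Proof. by move=> c2; apply/l2sqnorm_le; rewrite -l2_fineK. Qed.

Lemma sqsum_l2 c B : (forall N, sqsum N c <= B) -> l2 c.
Proof. by move/l2sqnorm_le => cB; rewrite /l2 (le_lt_trans cB)// ltry. Qed.

Lemma cvg_scalar_sqP (u : nat -> K) (l : K) :
  (u @ \oo --> l) <-> (forall e : R, 0 < e ->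
     exists N, forall n, (N <= n)%N -> scalar_abs (u n - l) ^+ 2 <= e).
Proof.
split=> [/cvg_scalarP ul e e0|ul].
  have se0 : 0 < Num.sqrt e by rewrite sqrtr_gt0.
  have [N _ uN] := ul _ se0; exists N => n Nn.
  rewrite -[leRHS]sqr_sqrtr ?(ltW e0)// ler_pXn2r ?nnegrE ?scalar_abs_ge0 ?ltW//.
  exact: uN.
apply/cvg_scalarP => e e0; have e20 : 0 < e ^+ 2 / 2.
  by rewrite divr_gt0// exprn_gt0.
have [N uN] := ul _ e20; exists N => // n /= /uN un.
rewrite -(@ltr_pXn2r _ 2) ?nnegrE ?scalar_abs_ge0 ?(ltW e0)//.
by rewrite (le_lt_trans un)// ltr_pdivrMr// ltr_pMr ?exprn_gt0// ltr1n.
Qed.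

Lemma cvg_scalarJ (u : nat -> K) (l : K) :
  u @ \oo --> l -> scalar_conj (u n) @[n --> \oo] --> scalar_conj l.
Proof.
move=> /cvg_scalarP ul; apply/cvg_scalarP => e /ul; apply: filterS => n.
by rewrite -scalar_conjN -scalar_conjD scalar_absJ.
Qed.

Lemma cvg_scalarZ (z : K) (u : nat -> K) (l : K) :
  u @ \oo --> l -> z * u n @[n --> \oo] --> z * l.
Proof. by move=> ul; apply: cvgM => //; exact: cvg_cst. Qed.

Lemma scalar_abs_dist (x y : K) :
  `|scalar_abs x - scalar_abs y| <= scalar_abs (x - y).
Proof.
rewrite ler_norml; have := scalar_absD (x - y) y; have := scalar_absD (y - x) x.
by rewrite !subrK -opprB scalar_absN; lra.
Qed.

Lemma cvg_sqabs (u : nat -> K) (l : K) : u @ \oo --> l ->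
  scalar_abs (u n) ^+ 2 @[n --> \oo] --> scalar_abs l ^+ 2.
Proof.
move=> /cvg_scalarP ul; apply: cvgM; apply/cvgrPdist_lt => e /ul;
  by apply: filterS => n; apply: le_lt_trans; rewrite distrC scalar_abs_dist.
Qed.

Lemma cvg_scalar_sum N (u : nat -> nat -> K) (l : nat -> K) :
  (forall i, u n i @[n --> \oo] --> l i) ->
  \sum_(i < N) u n i @[n --> \oo] --> \sum_(i < N) l i.
Proof.
move=> ul; elim: N => [|N ih].
  by under eq_fun do rewrite big_ord0; rewrite big_ord0; exact: cvg_cst.
under eq_fun do rewrite big_ord_recr/=; rewrite big_ord_recr/=.
by apply: cvgD.
Qed.

Lemma sqsum_le_cvg N (u : nat -> nat -> K) (l : nat -> K) B :
  (forall i, u n i @[n --> \oo] --> l i) ->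
  (\forall n \near \oo, sqsum N (u n) <= B) -> sqsum N l <= B.
Proof.
move=> ul uB; have : sqsum N (u n) @[n --> \oo] --> sqsum N l.
  rewrite /sqsum; elim: N {uB} => [|N ih].
    by under eq_fun do rewrite big_ord0; rewrite big_ord0; exact: cvg_cst.
  under eq_fun do rewrite big_ord_recr/=; rewrite big_ord_recr/=.
  by apply: cvgD => //; exact: cvg_sqabs.
move=> uc; exact: (cvgr_to_le uc uB).
Qed.

Lemma sqabs_le_cvg (u : nat -> K) (l z : K) (B : R) : u @ \oo --> l ->
  (\forall n \near \oo, scalar_abs (u n - z) ^+ 2 <= B) ->
  scalar_abs (l - z) ^+ 2 <= B.
Proof.
move=> ul uB; apply: cvgr_to_le uB.
by apply: cvg_sqabs; apply: cvgB => //; exact: cvg_cst.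
Qed.

(** The inequality 2 |x y| <= s |x|^2 + |y|^2 / s, summed. *)
Lemma re_sum_mul_le N a b (s : R) : 0 < s ->
  scalar_re (\sum_(j < N) a j * b j) <= 2^-1 * (s * sqsum N a + s^-1 * sqsum N b).
Proof.
move=> s0; rewrite scalar_re_sum /sqsum !mulr_sumr -big_split/= mulr_sumr.
apply: ler_sum => i _; apply: le_trans (ler_norm _) _.
rewrite (le_trans (scalar_re_le_abs _))// scalar_absM.
set x := scalar_abs _; set y := scalar_abs _.
rewrite -subr_ge0 (_ : _ - _ = 2^-1 * s * (x - y / s) ^+ 2).
  by rewrite mulr_ge0 ?sqr_ge0// mulr_ge0// ltW.
by field; rewrite gt_eqF.
Qed.

Lemma cvg_scalar_unique (u : nat -> K) (x y : K) :
  u @ \oo --> x -> u @ \oo --> y -> x = y.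
Proof. exact: (@cvg_unique _ (@norm_hausdorff _ _)). Qed.

End square_sums.

(** * Finite Riesz bounds and the Gram matrix *)

Section Riesz_system.
Context {R : realType} {k : scalar_kind}.
Context {d : measure_display} {T : measurableType d}.
Variable mu : {measure set T -> \bar R}.
Local Notation K := (scalar_field R k).
Local Notation ip := (L2inner mu).
Implicit Types (a b c : nat -> K) (f g : T -> K).

Definition synth (psi : nat -> T -> K) c N : T -> K :=
  fun x => \sum_(i < N) c i * psi i x.

Lemma L2_synth (psi : nat -> T -> K) c N : (forall i, L2 mu (psi i)) ->
  L2 mu (synth psi c N).
Proof. by move=> p2; apply: (@L2_sum _ _ _ _ _ N (fun i x => c i * psi i x)) => i; exact: L2Z. Qed.

Lemma synthB (psi : nat -> T -> K) a b N :
  (fun x => synth psi a N x - synth psi b N x) = synth psi (fun i => a i - b i) N.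
Proof.
apply/funext => x; rewrite /synth -sumrB; apply: eq_bigr => i _.
by rewrite mulrBl.
Qed.

Lemma synth_head (psi : nat -> T -> K) c M N : (M <= N)%N ->
  (forall i, (M <= i)%N -> c i = 0) -> synth psi c N = synth psi c M.
Proof.
move=> MN c0; apply/funext => x; rewrite /synth.
rewrite -(sum_truncate (fun i => c i * psi i x) MN); apply: eq_bigr => i _.
by case: ltnP => // /c0 ->; rewrite mul0r.
Qed.

Lemma synth_tail (psi : nat -> T -> K) c M N : (M <= N)%N ->
  (fun x => synth psi c N x - synth psi c M x) =
  synth psi (fun i => if (i < M)%N then 0 else c i) N.
Proof.
move=> MN; apply/funext => x; rewrite /synth.
rewrite -(sum_truncate (fun i => c i * psi i x) MN) -sumrB; apply: eq_bigr => i _.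
by case: ifP => _; rewrite ?subrr ?mul0r ?subr0.
Qed.

(** The inequality of a Riesz basis, for finite combinations only, so that all
    limits are limits in K or in l^2. For the products of two bases this form
    follows from Tonelli's theorem. *)
Record Riesz_system (psi : nat -> T -> K) (alpha beta : R) : Prop := RieszSystem {
  Riesz_L2 : forall i, L2 mu (psi i);
  Riesz_gt0 : 0 < alpha;
  Riesz_le : alpha <= beta;
  Riesz_lower : forall N c, alpha * sqsum N c <= L2sq mu (synth psi c N);
  Riesz_upper : forall N c, L2sq mu (synth psi c N) <= beta * sqsum N c }.

Variables (psi : nat -> T -> K) (alpha beta : R).
Hypothesis rs : Riesz_system psi alpha beta.

Let psi2 := Riesz_L2 rs.
Let alpha_gt0 := Riesz_gt0 rs.
Let beta_gt0 : 0 < beta := lt_le_trans alpha_gt0 (Riesz_le rs).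
Let sy := synth psi.
Let S2 c N : L2 mu (sy c N). Proof. exact: L2_synth. Qed.

Lemma L2sq_synth_tail c M N : (M <= N)%N ->
  L2sq mu (fun x => sy c N x - sy c M x) <= beta * (sqsum N c - sqsum M c).
Proof.
by move=> MN; rewrite synth_tail// -sqsum_tail//; exact: (Riesz_upper rs).
Qed.

Lemma ip_synthl c N g : L2 mu g -> ip (sy c N) g = \sum_(i < N) c i * ip (psi i) g.
Proof. by move=> g2; exact: ip_suml. Qed.

Lemma ip_synthr c N g : L2 mu g ->
  ip g (sy c N) = \sum_(i < N) scalar_conj (c i) * ip g (psi i).
Proof. by move=> g2; exact: ip_sumr. Qed.

(** For b_j = <f, psi_j> and g the sum of the b_j psi_j with j < N, the sum of
    the |b_j|^2 is <f, g>, and |g|^2 is at most beta times that sum; so the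
    bound follows from |beta f - g|^2 >= 0. *)
Lemma Bessel f N : L2 mu f ->
  sqsum N (fun j => ip f (psi j)) <= beta * L2sq mu f.
Proof.
move=> f2; set b := fun j => ip f (psi j); set g := sy b N.
have s0 : sqsum N b = scalar_re (ip f g).
  rewrite ip_synthr// scalar_re_sum; apply: eq_bigr => i _.
  by rewrite mulrC scalar_mulJ scalar_re_of.
have := L2sq_ge0 mu (fun x => scalar_emb beta * f x - g x).
rewrite L2sqB//; [|exact: L2Z|exact: S2].
rewrite L2sqZ// ipZl//; last exact: S2.
rewrite scalar_abs_emb ?(ltW beta_gt0)// scalar_reM scalar_re_of.
rewrite scalar_im_emb mul0r subr0 -s0.
have := Riesz_upper rs N b; rewrite -/sy -/g => gb h.
have : 0 <= beta * (beta * L2sq mu f - sqsum N b) by lra.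
by rewrite pmulr_rge0// subr_ge0.
Qed.

Lemma ip_psi_le f j : L2 mu f ->
  scalar_abs (ip f (psi j)) ^+ 2 <= beta * L2sq mu f.
Proof.
move=> f2; apply: le_trans (Bessel j.+1 f2).
exact: (sqsum_ge_term j (fun j => ip f (psi j))).
Qed.

(** The product c R of the row c by the Gram matrix R of psi is b; for f the
    sum of the c_i psi_i, this says that <f, psi_j> = b_j for all j. *)
Definition Gram_row c b := forall j, ip (sy c N) (psi j) @[N --> \oo] --> b j.

(** R maps l^2 to l^2: the partial sums of the c_i psi_i form a Cauchy sequence
    by the upper Riesz bound, and Bessel's inequality bounds their inner
    products with the psi_j. *)
Lemma Gram_row_exists c B : (forall N, sqsum N c <= B) ->
  exists b, Gram_row c b /\ forall N, sqsum N b <= beta ^+ 2 * B.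
Proof.
move=> cB.
have cv j : exists l : K, ip (sy c N) (psi j) @[N --> \oo] --> l.
  apply: scalar_cauchy_cvg => e e0.
  (* two factors beta: one from Bessel, one from the upper Riesz bound *)
  have e20 : 0 < e ^+ 2 / 2 / beta ^+ 2 by rewrite !divr_gt0// exprn_gt0.
  have [M tailM] := nondecreasing_bounded_tail (sqsum_homo c) cB e20.
  have main m n : (M <= m)%N -> (m <= n)%N ->
      scalar_abs (ip (sy c n) (psi j) - ip (sy c m) (psi j)) < e.
    move=> Mm mn; rewrite -ipBl//; try exact: S2.
    rewrite -(@ltr_pXn2r _ 2) ?nnegrE ?scalar_abs_ge0 ?(ltW e0)//.
    apply: le_lt_trans (ip_psi_le _ (L2B (S2 c n) (S2 c m))) _.
    apply: (@le_lt_trans _ _ (beta * (beta * (e ^+ 2 / 2 / beta ^+ 2)))).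
      rewrite ler_pM2l//; apply: le_trans (L2sq_synth_tail c mn) _.
      by rewrite ler_pM2l// tailM.
    rewrite (_ : beta * _ = e ^+ 2 / 2); last by field; rewrite gt_eqF.
    by rewrite ltr_pdivrMr// ltr_pMr ?exprn_gt0// ltr1n.
  exists M => m n Mm Mn; case: (leqP m n) => [mn|/ltnW nm].
    by rewrite -scalar_absN opprB; exact: main.
  exact: main.
have [b bP] := choice cv; exists b; split => // N.
apply: (sqsum_le_cvg bP); apply: nearW => n.
apply: le_trans (Bessel N (S2 c n)) _; rewrite expr2 -mulrA ler_pM2l//.
by apply: le_trans (Riesz_upper rs n c) _; rewrite ler_pM2l.
Qed.

(** The Gram matrix of psi_0, ..., psi_{n-1} is invertible, and the rows of
    its inverse give the combination with prescribed inner products. *)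
Lemma finite_section n : exists M : nat -> nat -> K, forall b j, (j < n)%N ->
  ip (sy (fun i => \sum_(l < n) b l * M l i) n) (psi j) = b j.
Proof.
pose G : 'M[K]_n := \matrix_(i, j) ip (psi i) (psi j).
have Gu : G \in unitmx.
  rewrite -row_free_unit; apply: inj_row_free => v vG.
  pose c (i : nat) : K := if insub i is Some i' then v ord0 i' else 0.
  have cE (i : 'I_n) : c i = v ord0 i by rewrite /c valK.
  have orth (j : 'I_n) : ip (sy c n) (psi j) = 0.
    rewrite ip_synthl//; move/matrixP : vG => /(_ ord0 j); rewrite !mxE => vG.
    by rewrite -[RHS]vG; apply: eq_bigr => i _; rewrite cE mxE.
  have : L2sq mu (sy c n) = 0.
    rewrite L2sqE ip_synthr ?S2// big1 ?scalar_re0// => i _.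
    by rewrite orth mulr0.
  move=> S0; have := Riesz_lower rs n c; rewrite -/sy S0 pmulr_rle0// => c0.
  have {}c0 : sqsum n c = 0 by apply/eqP; rewrite eq_le c0 sqsum_ge0.
  apply/rowP => i; rewrite mxE -cE.
  apply: scalar_abs_eq0; apply/eqP; rewrite -sqrf_eq0; apply/eqP.
  move: c0; rewrite /sqsum => /eqP; rewrite psumr_eq0 => [|i0 _]; last exact: sqr_ge0.
  by move=> /allP /(_ i (mem_index_enum _)) /eqP.
pose M (l i : nat) : K :=
  if insub l is Some l' then if insub i is Some i' then invmx G l' i' else 0
  else 0.
exists M => b j jn; rewrite ip_synthl//.
pose r : 'rV[K]_n := \row_l b l.
have := congr1 (fun A : 'rV[K]_n => A ord0 (Ordinal jn)) (mulmxKV Gu r).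
rewrite [in RHS]mxE/= => <-; rewrite mxE; apply: eq_bigr => i _.
rewrite [G _ _]mxE; congr (_ * _); rewrite mxE; apply: eq_bigr => l _.
by rewrite mxE /M !valK.
Qed.

(** The Gram matrix is onto: the combinations f_n of psi_0, ..., psi_{n-1} with
    <f_n, psi_j> = b_j for j < n are the orthogonal projections of each
    other, so their norms increase to a limit and their coefficients converge
    in l^2. *)
Lemma Gram_row_onto b B : (forall N, sqsum N b <= B) ->
  exists c, Gram_row c b /\ forall N, sqsum N c <= alpha^-1 ^+ 2 * B.
Proof.
move=> bB.
have sec n : exists cn : nat -> K, (forall i, (n <= i)%N -> cn i = 0) /\
    forall j, (j < n)%N -> ip (sy cn n) (psi j) = b j.
  have [M MP] := finite_section n.
  exists (fun i => if (i < n)%N then \sum_(l < n) b l * M l i else 0); split.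
    by move=> i ni; rewrite ltnNge ni.
  move=> j jn; rewrite -(MP b j jn); congr (ip _ _).
  by apply/funext => x; apply: eq_bigr => i _; rewrite ltn_ord.
have [C /all_and2 [C0 CP]] := choice sec.
pose f n := sy (C n) n.
have SC n N : (n <= N)%N -> sy (C n) N = f n.
  by move=> nN; apply: synth_head => // i; exact: C0.
have fB n : L2sq mu (f n) <= alpha^-1 * B.
  have : L2sq mu (f n) <= 2^-1 * (alpha * sqsum n (C n) + alpha^-1 * sqsum n b).
    rewrite L2sqE ip_synthr; last exact: S2.
    rewrite -(sqsumJ _ (C n)).
    apply: le_trans _ (re_sum_mul_le _ _ _ alpha_gt0).
    by rewrite le_eqVlt; apply/orP; left; apply/eqP; congr scalar_re;
      apply: eq_bigr => j _; rewrite CP.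
  have := Riesz_lower rs n (C n); rewrite -/sy -/(f n).
  have : alpha^-1 * sqsum n b <= alpha^-1 * B by rewrite ler_pM2l ?invr_gt0.
  lra.
(* f_m is the projection of f_n, so the squared norms subtract *)
have gap m n : (m <= n)%N ->
    L2sq mu (fun x => f n x - f m x) = L2sq mu (f n) - L2sq mu (f m).
  move=> mn; rewrite L2sqB; [|exact: S2|exact: S2].
  have -> : ip (f n) (f m) = ip (f m) (f m).
    rewrite !ip_synthr; [|exact: S2|exact: S2].
    by apply: eq_bigr => j _; rewrite !CP// (leq_trans _ mn).
  by rewrite -L2sqE; lra.
have nd : {homo (fun n => L2sq mu (f n)) : m n / (m <= n)%N >-> m <= n}.
  by move=> m n mn; rewrite -subr_ge0 -gap// L2sq_ge0.
have coef m n N : (m <= n)%N -> sqsum N (fun i => C n i - C m i) <=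
    alpha^-1 * (L2sq mu (f n) - L2sq mu (f m)).
  move=> mn; apply: le_trans (sqsum_homo _ (leq_maxl N n)) _.
  rewrite -(ler_pM2l alpha_gt0) mulVKf ?gt_eqF// -gap//.
  apply: le_trans (Riesz_lower rs _ _) _; rewrite -synthB.
  by rewrite -/sy (SC n) ?(SC m) ?leq_maxr// (leq_trans mn)// leq_maxr.
have small (e : R) : 0 < e -> exists M, forall m n N, (M <= m)%N -> (m <= n)%N ->
    sqsum N (fun i => C n i - C m i) <= e.
  move=> e0; have ae0 : 0 < alpha * e by rewrite mulr_gt0.
  have [M MP] := nondecreasing_bounded_tail nd fB ae0.
  exists M => m n N Mm mn; apply: le_trans (coef m n N mn) _.
  by rewrite ler_pdivrMl// MP.
have cv i : exists l : K, C n i @[n --> \oo] --> l.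
  apply: scalar_cauchy_cvg => e e0.
  have e20 : 0 < e ^+ 2 / 2 by rewrite divr_gt0// exprn_gt0.
  have [M MP] := small _ e20.
  have main m n : (M <= m)%N -> (m <= n)%N -> scalar_abs (C n i - C m i) < e.
    move=> Mm mn; rewrite -(@ltr_pXn2r _ 2) ?nnegrE ?scalar_abs_ge0 ?(ltW e0)//.
    apply: le_lt_trans (sqsum_ge_term i (fun i => C n i - C m i)) _.
    apply: le_lt_trans (MP m n _ Mm mn) _.
    by rewrite ltr_pdivrMr// ltr_pMr ?exprn_gt0// ltr1n.
  exists M => m n Mm Mn; case: (leqP m n) => [mn|/ltnW nm]; last exact: main.
  by rewrite -scalar_absN opprB; exact: main.
have [c cP] := choice cv; exists c; split; last first.
  move=> N; apply: (sqsum_le_cvg cP); apply: nearW => n.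
  rewrite -(ler_pM2l alpha_gt0) expr2 -mulrA mulVKf ?gt_eqF//.
  apply: le_trans (fB n).
  have -> : f n = sy (C n) (maxn N n) by rewrite SC// leq_maxr.
  apply: le_trans (Riesz_lower rs _ _).
  by rewrite ler_pM2l// sqsum_homo// leq_maxl.
move=> j; apply/cvg_scalar_sqP => e e0.
have e'0 : 0 < e / beta ^+ 2 by rewrite divr_gt0// exprn_gt0.
have [M MP] := small _ e'0.
pose m := maxn M j.+1; exists m => N mN.
rewrite -(CP m j); last by rewrite leq_maxr.
rewrite -ipBl//; try exact: S2.
rewrite -/(f m) -(SC m N mN) synthB.
apply: le_trans (ip_psi_le j (S2 _ N)) _.
rewrite -ler_pdivlMl//; apply: le_trans (Riesz_upper rs _ _) _.
rewrite -ler_pdivlMl//.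
apply: (@sqsum_le_cvg _ _ N (fun n i => C n i - C m i)).
  by move=> i; apply: cvgB => //; exact: cvg_cst.
exists m => // n /= mn; apply: le_trans (MP m n N (leq_maxl _ _) mn) _.
by rewrite le_eqVlt; apply/orP; left; apply/eqP; field; rewrite gt_eqF.
Qed.

(** Associativity (c R) a = c (R a), where R a is expressed through rows by
    the symmetry of R: both sides are limits of <f_N, g_N> for the partial
    sums f_N of the c_i psi_i and g_N of the conj(a_j) psi_j. *)
Lemma Gram_associative c b a a' Bc Ba :
  (forall N, sqsum N c <= Bc) -> (forall N, sqsum N a <= Ba) ->
  Gram_row c b -> Gram_row (scalar_conj \o a) (scalar_conj \o a') ->
  \sum_(j < N) b j * a j - \sum_(i < N) c i * a' i @[N --> \oo] --> (0 : K).
Proof.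
move=> cB aB cb aa'; pose A := scalar_conj \o a.
have AB N : sqsum N A <= Ba by rewrite sqsumJ.
have Ba0 : 0 <= Ba by exact: le_trans (sqsum_ge0 0 A) (AB 0).
have Bc0 : 0 <= Bc by exact: le_trans (sqsum_ge0 0 c) (cB 0).
have limb M : ip (sy c N) (sy A M) @[N --> \oo] --> \sum_(j < M) b j * a j.
  under eq_fun do rewrite ip_synthr ?S2//.
  apply: (@cvg_scalar_sum _ _ M (fun N j => scalar_conj (A j) * ip (sy c N) (psi j)) (fun j => b j * a j)) => j; rewrite /A /= scalar_conjK [b j * _]mulrC.
  by apply: (@cvg_scalarZ _ _ _ (fun N => ip (sy c N) (psi j))); exact: cb.
have limc N : ip (sy c N) (sy A M) @[M --> \oo] --> \sum_(i < N) c i * a' i.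
  under eq_fun do rewrite ip_synthl ?S2//.
  apply: (@cvg_scalar_sum _ _ N (fun M i => c i * ip (psi i) (sy A M)) (fun i => c i * a' i)) => i; apply: (@cvg_scalarZ _ _ _ (fun M => ip (psi i) (sy A M))).
  under eq_fun do rewrite ipJ ?S2//.
  by rewrite -[a' i]scalar_conjK; apply: cvg_scalarJ; exact: aa'.
apply/cvg_scalar_sqP => e e0.
(* |<f_n - f_N, g_N>|^2 is at most beta^2 times the tail of c times Ba, and
   symmetrically; the summand 1 keeps D positive *)
pose D := beta ^+ 2 * (Ba + Bc + 1).
have D0 : 0 < D by rewrite mulr_gt0 ?exprn_gt0// ltr_wpDl ?addr_ge0.
pose e1 := e / 4 / D; have e10 : 0 < e1 by rewrite !divr_gt0.
have [M1 tc] := nondecreasing_bounded_tail (sqsum_homo c) cB e10.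
have [M2 ta] := nondecreasing_bounded_tail (sqsum_homo A) AB e10.
have bound (x y : T -> K) s t : L2 mu x -> L2 mu y -> 0 <= t -> t <= Ba + Bc ->
    L2sq mu x <= beta * s -> L2sq mu y <= beta * t -> s <= e1 ->
    scalar_abs (ip x y) ^+ 2 <= e / 4.
  move=> x2 y2 t0 tB xs yt se; apply: le_trans (Cauchy_Schwarz x2 y2) _.
  apply: (@le_trans _ _ ((beta * e1) * (beta * (Ba + Bc + 1)))).
    apply: ler_pM; rewrite ?L2sq_ge0//.
      by apply: le_trans xs _; rewrite ler_pM2l.
    by apply: le_trans yt _; rewrite ler_pM2l// (le_trans tB)// lerDl.
  rewrite le_eqVlt; apply/orP; left; apply/eqP; rewrite /e1 /D.
  by field; rewrite !gt_eqF//; apply: ltr_wpDl; rewrite ?addr_ge0.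
exists (maxn M1 M2) => N; rewrite geq_max => /andP[M1N M2N]; rewrite subr0.
have hb : scalar_abs (\sum_(j < N) b j * a j - ip (sy c N) (sy A N)) ^+ 2 <= e / 4.
  apply: (sqabs_le_cvg (limb N)); exists N => // n /= Nn.
  rewrite -ipBl; try exact: S2.
  apply: (bound _ _ (sqsum n c - sqsum N c) (sqsum N A)) => //.
  - by apply: L2B; exact: S2.
  - exact: sqsum_ge0.
  - by rewrite (le_trans (AB N))// lerDl.
  - exact: L2sq_synth_tail.
  - exact: (Riesz_upper rs).
  - exact: tc.
have hc : scalar_abs (\sum_(i < N) c i * a' i - ip (sy c N) (sy A N)) ^+ 2 <= e / 4.
  apply: (sqabs_le_cvg (limc N)); exists N => // n /= Nn.
  rewrite -ipBr; try exact: S2.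
  rewrite ipJ ?scalar_absJ; [|by apply: L2B; exact: S2|exact: S2].
  apply: (bound _ _ (sqsum n A - sqsum N A) (sqsum N c)) => //.
  - by apply: L2B; exact: S2.
  - exact: sqsum_ge0.
  - by rewrite (le_trans (cB N))// lerDr.
  - exact: L2sq_synth_tail.
  - exact: (Riesz_upper rs).
  - exact: ta.
set z := ip _ _ in hb hc.
rewrite (_ : _ - _ = (\sum_(j < N) b j * a j - z) +
                     - (\sum_(i < N) c i * a' i - z)); last by ring.
apply: le_trans (scalar_sqabsD _ _) _; rewrite scalar_absN; lra.
Qed.

(** By duality. Let h be c truncated at N and let a solve R a = conj(h), so that
    |a|^2 <= |h|^2 / alpha^2. By associativity b a = c (R a) = |h|^2, and the
    weighted inequality for 2 |b_j a_j| bounds the left side by half of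
    |h|^2 + |b|^2 / alpha^2. *)
Lemma Gram_row_bounded_below c b Bc B :
  (forall N, sqsum N c <= Bc) -> Gram_row c b ->
  (forall N, sqsum N b <= B) ->
  forall N, sqsum N c <= alpha^-1 ^+ 2 * B.
Proof.
move=> cB cb bB N; set s := sqsum N c.
pose h i := if (i < N)%N then c i else 0.
have hB n : sqsum n h <= s.
  apply: le_trans (sqsum_homo _ (leq_maxl n N)) _.
  by rewrite sqsum_head// leq_maxr.
have [A [Ah AB]] := Gram_row_onto hB.
pose a := scalar_conj \o A.
have aB n : sqsum n a <= alpha^-1 ^+ 2 * s by rewrite sqsumJ.
have := @Gram_associative c b a (scalar_conj \o h) _ _ cB aB cb.
have -> : scalar_conj \o a = A by apply/funext => i /=; rewrite scalar_conjK.
have -> : scalar_conj \o (scalar_conj \o h) = h.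
  by apply/funext => i /=; rewrite scalar_conjK.
move=> /(_ Ah) lim.
have lower n : (N <= n)%N -> 2^-1 * (s - alpha^-1 ^+ 2 * B) <=
   scalar_abs (\sum_(j < n) b j * a j - \sum_(i < n) c i * (scalar_conj \o h) i).
  move=> Nn; rewrite -scalar_absN; apply: le_trans _ (scalar_re_le_abs _).
  apply: le_trans _ (ler_norm _); rewrite scalar_reN scalar_reD scalar_reN.
  have -> : scalar_re (\sum_(i < n) c i * (scalar_conj \o h) i) = s.
    rewrite scalar_re_sum /s -(sqsum_head c Nn); apply: eq_bigr => i _ /=.
    rewrite /h; case: ifP => _; first by rewrite scalar_mulJ scalar_re_of.
    by rewrite scalar_conj0 mulr0 scalar_re0 scalar_abs0 expr0n.
  have al2 : 0 < alpha^-1 ^+ 2 by rewrite exprn_gt0// invr_gt0.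
  have := re_sum_mul_le n b a al2.
  have h1 : alpha^-1 ^+ 2 * sqsum n b <= alpha^-1 ^+ 2 * B by rewrite ler_pM2l.
  have h2 : (alpha^-1 ^+ 2)^-1 * sqsum n a <= s.
    by rewrite ler_pdivrMl//.
  lra.
rewrite leNgt; apply/negP; rewrite -subr_gt0 => pos.
have /cvg_scalarP /(_ (2^-1 * (s - alpha^-1 ^+ 2 * B))) := lim.
rewrite mulr_gt0// => /(_ isT) [M _ MP].
have := MP (maxn M N) (leq_maxl _ _); rewrite subr0.
by rewrite ltNge lower// leq_maxr.
Qed.

(** Choose a finite combination g of the psi_i close to f. The coefficients h of
    g - f satisfy h R = <g - f, psi_j>, which is small in l^2 by Bessel's
    inequality; so h is small, and with it the combination of the psi_i with
    coefficients h, uniformly in the number of terms. *)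
Lemma Riesz_expansion f c B : L2_complete mu psi -> L2 mu f ->
  (forall N, sqsum N c <= B) -> Gram_row c (fun j => ip f (psi j)) ->
  L2_series mu c psi f.
Proof.
move=> compl f2 cB cf; apply/cvg_L2normP => e e0.
(* the bound obtained below is D times the squared distance from f to g *)
pose D := 2 * (1 + beta * (alpha^-1 ^+ 2 * beta)).
have D0 : 0 < D.
  rewrite mulr_gt0// ltr_wpDr// mulr_ge0 ?(ltW beta_gt0)//.
  by rewrite mulr_ge0 ?sqr_ge0 ?(ltW beta_gt0).
have eD0 : 0 < Num.sqrt (e / D) by rewrite sqrtr_gt0 divr_gt0.
have [M [g0 g0f]] := compl f f2 _ eD0.
pose g i := if (i < M)%N then g0 i else 0.
have Sg N : (M <= N)%N -> sy g N = sy g M.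
  by move=> MN; apply: synth_head => // i; rewrite /g ltnNge => ->.
have g2 : L2 mu (sy g M) by exact: S2.
have fg : L2sq mu (fun x => f x - sy g M x) <= e / D.
  have fg2 := L2B f2 g2.
  rewrite -lee_fin -L2_sqint// -[e / D]sqr_sqrtr; last by rewrite ltW ?divr_gt0.
  rewrite ltW// -L2norm_ltE//.
  suff -> : (fun x => f x - sy g M x) = (fun x => f x - \sum_(i < M) g0 i * psi i x).
    by [].
  apply/funext => x; congr (_ - _); apply: eq_bigr => i _.
  by rewrite /g ltn_ord.
pose h i := g i - c i.
have hB N : sqsum N h <= 2 * (sqsum M g + B).
  have hle : sqsum N h <= 2 * (sqsum N g + sqsum N c).
    rewrite /sqsum -big_split/= mulr_sumr; apply: ler_sum => i _.
    by apply: le_trans (scalar_sqabsD _ _) _; rewrite scalar_absN.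
  apply: le_trans hle _; rewrite ler_pM2l// lerD//.
  apply: le_trans (sqsum_homo _ (leq_maxl N M)) _.
  rewrite -(sqsum_head g (leq_maxr N M)) le_eqVlt; apply/orP; left; apply/eqP.
  by apply: eq_bigr => i _; rewrite /g; case: ifP.
have hrow : Gram_row h (fun j => ip (fun x => sy g M x - f x) (psi j)).
  move=> j; rewrite ipBl//.
  have e1 : (fun N => ip (sy h N) (psi j)) =
            (fun N => ip (sy g N) (psi j) - ip (sy c N) (psi j)).
    by apply/funext => N; rewrite -ipBl ?S2//; rewrite synthB.
  rewrite e1; apply: cvgB; last exact: cf.
  apply: cvg_near_cst; exists M => // N /= MN.
  by rewrite Sg.
have gf : L2sq mu (fun x => sy g M x - f x) <= e / D.
  rewrite (_ : (fun _ => _) = (fun x => (-1) * (f x - sy g M x))); last first.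
    by apply/funext => x; ring.
  rewrite L2sqZ; last exact: L2B.
  rewrite scalar_absN (_ : scalar_abs 1 = 1) ?expr1n ?mul1r//.
  rewrite /scalar_abs normr1; by case: (k).
have hsmall := Gram_row_bounded_below hB hrow (fun N => Bessel N (L2B g2 f2)).
exists M => // N /= MN.
have -> : (fun x => f x - \sum_(i < N) c i * psi i x) =
          (fun x => (f x - sy g M x) + sy h N x).
  apply/funext => x; rewrite -[sy h N]/(synth psi h N) /h -synthB -/sy Sg//.
  by rewrite addrA subrK.
have fg2 := L2B f2 g2.
apply: le_trans (sqintD mu (L2_measurable fg2) (L2_measurable (S2 h N))) _.
rewrite L2_sqint// L2_sqint ?S2// -EFinD -EFinM lee_fin.
have hN : L2sq mu (sy h N) <= beta * (alpha^-1 ^+ 2 * (beta * (e / D))).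
  apply: le_trans (Riesz_upper rs N h) _; rewrite ler_pM2l//.
  apply: le_trans (hsmall N) _; rewrite ler_pM2l ?exprn_gt0 ?invr_gt0//.
  by rewrite ler_pM2l.
apply: (@le_trans _ _ (2 * (e / D + beta * (alpha^-1 ^+ 2 * (beta * (e / D)))))).
  by rewrite ler_pM2l// lerD.
rewrite (_ : 2 * _ = e / D * D); last by rewrite /D; ring.
by rewrite divfK// gt_eqF.
Qed.

End Riesz_system.

(** * The inverse of the Gram matrix *)

Section Gram_inverse.
Context {R : realType} {k : scalar_kind}.
Context {d : measure_display} {T : measurableType d}.
Variable mu : {measure set T -> \bar R}.
Local Notation K := (scalar_field R k).
Local Notation ip := (L2inner mu).
Variables (psi : nat -> T -> K) (alpha beta : R).
Hypothesis rs : Riesz_system mu psi alpha beta.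
Let psi2 := Riesz_L2 rs.
Let G (i j : nat) := ip (psi i) (psi j).
Local Notation Gram_row := (Gram_row mu psi).

(** R is Hermitian, so its action on columns is, up to conjugation, its action
    on rows. *)
Lemma mx_acts_Gram (a b : nat -> K) :
  mx_acts G a b <-> Gram_row (scalar_conj \o a) (scalar_conj \o b).
Proof.
have E i : (fun N => ip (synth psi (scalar_conj \o a) N) (psi i)) =
           (fun N => scalar_conj (\sum_(j < N) G i j * a j)).
  apply/funext => N; rewrite (ip_synthl rs)// scalar_conj_sum.
  by apply: eq_bigr => j _; rewrite /= scalar_conjM /G -ipJ// mulrC.
split=> [ab i|ab i]; first by rewrite E; apply: cvg_scalarJ; exact: ab.
have := ab i; rewrite E => /cvg_scalarJ; rewrite /= scalar_conjK.
by under eq_fun do rewrite scalar_conjK.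
Qed.

Lemma Gram_l2_operator : l2_operator G.
Proof.
exists (beta ^+ 2) => a a2.
have aB N : sqsum N (scalar_conj \o a) <= fine (l2sqnorm a).
  by rewrite sqsumJ; exact: l2_sqsum.
have [b [ab bB]] := Gram_row_exists rs aB.
have bB' N : sqsum N (scalar_conj \o b) <= beta ^+ 2 * fine (l2sqnorm a).
  by rewrite sqsumJ.
exists (scalar_conj \o b); split.
- exact: sqsum_l2 bB'.
- apply/mx_acts_Gram.
  rewrite (_ : scalar_conj \o (scalar_conj \o b) = b)//.
  by apply/funext => i /=; rewrite scalar_conjK.
- by rewrite (l2_fineK a2) -EFinM; exact/l2sqnorm_le.
Qed.

Lemma Gram_onto (b : nat -> K) : l2 b -> exists a : nat -> K,
  [/\ l2 a, mx_acts G a b &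
     (l2sqnorm a <= (alpha^-1 ^+ 2)%:E * l2sqnorm b)%E].
Proof.
move=> b2; have bB N : sqsum N (scalar_conj \o b) <= fine (l2sqnorm b).
  by rewrite sqsumJ; exact: l2_sqsum.
have [a [ab aB]] := Gram_row_onto rs bB.
have aB' N : sqsum N (scalar_conj \o a) <= alpha^-1 ^+ 2 * fine (l2sqnorm b).
  by rewrite sqsumJ.
exists (scalar_conj \o a); split.
- exact: sqsum_l2 aB'.
- apply/mx_acts_Gram.
  rewrite (_ : scalar_conj \o (scalar_conj \o a) = a)//.
  by apply/funext => i /=; rewrite scalar_conjK.
- by rewrite (l2_fineK b2) -EFinM; exact/l2sqnorm_le.
Qed.

Definition basis_vector (j i : nat) : K := (i == j)%:R.

Lemma sum_basis_vectorr (c : nat -> K) j N : (j < N)%N ->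
  \sum_(i < N) c i * basis_vector j i = c j.
Proof.
move=> jN; rewrite (bigD1 (Ordinal jN))//= /basis_vector eqxx mulr1 big1 ?addr0//.
move=> i ij; rewrite (_ : (i : nat) == j = false) ?mulr0//.
by apply/negbTE; apply: contra ij => /eqP ij; apply/eqP/val_inj.
Qed.

Lemma cvg_sum_basis_vectorr (c : nat -> K) j :
  \sum_(i < N) c i * basis_vector j i @[N --> \oo] --> c j.
Proof.
apply: cvg_near_cst; exists j.+1 => // N /= jN.
exact: sum_basis_vectorr.
Qed.

Lemma sqsum_basis_vector j N : sqsum N (basis_vector j) <= 1.
Proof.
apply: le_trans (sqsum_homo _ (leq_maxl N j.+1)) _.
rewrite /sqsum le_eqVlt; apply/orP; left; apply/eqP.
have jN : (j < maxn N j.+1)%N by rewrite leq_maxr.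
rewrite (bigD1 (Ordinal jN))//= /basis_vector eqxx big1 ?addr0.
  by rewrite /scalar_abs normr1; case: (k); rewrite ?expr1n.
move=> i ij; rewrite (_ : (i : nat) == j = false) ?scalar_abs0 ?expr0n//.
by apply/negbTE; apply: contra ij => /eqP ij; apply/eqP/val_inj.
Qed.

(** The rows r of the inverse solve r R = e_j; that r applied to R a gives a_j
    is the associativity of the products with R. Because R is onto, its
    left inverse is a two-sided inverse. The coefficients c of f solve
    c R = <f, psi_j>, and c = (c R) R^-1 is associativity again, now with the
    columns of R^-1, which solve R a = e_j. *)
Lemma Gram_inverse_expansion : L2_complete mu psi ->
  exists Ginv : nat -> nat -> K, l2_inverse G Ginv /\
    forall f, L2 mu f -> exists c : nat -> K,
      (forall j, dot_series (fun l => ip f (psi l)) (fun l => Ginv l j) (c j)) /\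
      L2_series mu c psi f.
Proof.
move=> compl.
have rows j : exists r : nat -> K, Gram_row r (basis_vector j) /\
    forall N, sqsum N r <= alpha^-1 ^+ 2 * 1.
  exact: (Gram_row_onto rs (sqsum_basis_vector j)).
have [Ginv /all_and2 [GinvP GinvB]] := choice rows.
have left_inverse a b : l2 a -> mx_acts G a b -> mx_acts Ginv b a.
  move=> a2 /mx_acts_Gram ab j.
  have := Gram_associative rs (GinvB j) (l2_sqsum a2) (GinvP j) ab.
  move=> lim; rewrite -[a j]subr0 /dot_series.
  rewrite (_ : (fun N => _) = (fun N => \sum_(i < N) a i * basis_vector j i -
     (\sum_(i < N) basis_vector j i * a i - \sum_(i < N) Ginv j i * b i))).
    exact: cvgB (@cvg_sum_basis_vectorr a j) lim.
  apply/funext => N; under [X in _ - (X - _)]eq_bigr do rewrite mulrC.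
  by rewrite subKr.
exists Ginv; split.
  split; first exact: Gram_l2_operator.
    exists (alpha^-1 ^+ 2) => b b2; have [a [a2 ab ale]] := Gram_onto b2.
    by exists a; split => //; exact: left_inverse.
  move=> a b a2 b2; split; first exact: left_inverse.
  move=> ba; have [a' [a'2 a'b _]] := Gram_onto b2.
  have ba' := left_inverse _ _ a'2 a'b.
  suff -> : a = a' by [].
  by apply/funext => j; exact: cvg_scalar_unique (ba j) (ba' j).
move=> f f2; have [c [cf cB]] := Gram_row_onto rs (fun N => Bessel rs N f2).
exists c; split; last exact: (Riesz_expansion rs compl f2 cB cf).
move=> j.
have e2 : l2 (basis_vector j) by exact: sqsum_l2 (sqsum_basis_vector j).
have [a [a2 aj _]] := Gram_onto e2.
(* the column j of the inverse is the solution a of R a = e_j, hence in l^2 *)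
have aE l : Ginv l j = a l.
  have := left_inverse _ _ a2 aj l => al.
  exact: cvg_scalar_unique (@cvg_sum_basis_vectorr (Ginv l) j) al.
rewrite /dot_series; under eq_fun do under eq_bigr do rewrite aE.
move/mx_acts_Gram : aj => aj.
have lim := Gram_associative rs cB (l2_sqsum a2) cf aj.
rewrite -[c j]add0r.
rewrite (_ : (fun N => _) = (fun N => (\sum_(i < N) ip f (psi i) * a i -
  \sum_(i < N) c i * basis_vector j i) + \sum_(i < N) c i * basis_vector j i)).
  exact: cvgD lim (@cvg_sum_basis_vectorr c j).
by apply/funext => N; rewrite subrK.
Qed.

End Gram_inverse.

(** * From Riesz bases to finite bounds; best approximation; enumerations *)

Section Riesz_basis.
Context {R : realType} {k : scalar_kind}.
Context {d : measure_display} {T : measurableType d}.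
Variable mu : {measure set T -> \bar R}.
Local Notation K := (scalar_field R k).
Local Notation ip := (L2inner mu).

(** By Cauchy-Schwarz, f and g have the same inner product with every h. *)
Lemma L2sq_eq_dist0 (f g : T -> K) : L2 mu f -> L2 mu g ->
  L2sq mu (fun x => f x - g x) = 0 -> L2sq mu f = L2sq mu g.
Proof.
move=> f2 g2 fg0.
have eq_ip h : L2 mu h -> ip f h = ip g h.
  move=> h2; apply/eqP; rewrite -subr_eq0 -ipBl//; apply/eqP.
  apply: scalar_abs_eq0; apply/eqP; rewrite -sqrf_eq0 eq_le sqr_ge0 andbT.
  by apply: le_trans (Cauchy_Schwarz (L2B f2 g2) h2) _; rewrite fg0 mul0r.
by rewrite !L2sqE eq_ip// ipJ// eq_ip// -ipJ.
Qed.

(** For a finitely supported c the partial sums are eventually constant, so the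
    sum given by the definition of a Riesz basis is the finite combination. *)
Lemma Riesz_basis_system (psi : nat -> T -> K) : L2_Riesz_basis mu psi ->
  exists alpha beta, Riesz_system mu psi alpha beta.
Proof.
move=> [psi2 _ [alpha [beta [a0 ab bounds]]]]; exists alpha, beta.
suff main N c : alpha * sqsum N c <= L2sq mu (synth psi c N) <= beta * sqsum N c.
  by split => // N c; have /andP[] := main N c.
pose h i := if (i < N)%N then c i else 0.
have hB n : sqsum n h <= sqsum N c.
  apply: le_trans (sqsum_homo _ (leq_maxl n N)) _.
  by rewrite sqsum_head// leq_maxr.
have h2 : l2 h by exact: sqsum_l2 hB.
have hE : l2sqnorm h = (sqsum N c)%:E.
  apply/eqP; rewrite eq_le; apply/andP; split; first exact/l2sqnorm_le.
  by rewrite (l2_fineK h2) lee_fin -(sqsum_head c (leqnn N)) l2_sqsum.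
have synth_h n : (N <= n)%N -> synth psi h n = synth psi c N.
  move=> Nn; rewrite (@synth_head _ _ _ _ _ h N)// => [|i]; last first.
    by rewrite /h ltnNge => ->.
  by apply/funext => x; apply: eq_bigr => i _; rewrite /h ltn_ord.
have [f [f2 /cvg_L2normP fs]] := bounds h h2.
have S2 : L2 mu (synth psi c N) by exact: L2_synth.
rewrite -sqint_sqr_L2norm L2_sqint// hE -!EFinM !lee_fin.
rewrite (L2sq_eq_dist0 f2 S2)//.
apply/eqP; rewrite eq_le L2sq_ge0 andbT; apply/ler_addgt0Pr => e e0.
have [M _ MP] := fs e e0; rewrite add0r -lee_fin -L2_sqint; last exact: L2B.
have := MP (maxn M N) (leq_maxl _ _); apply: le_trans.
by rewrite -(synth_h (maxn M N)) ?leq_maxr.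
Qed.

(** The combination of psi_0, ..., psi_{n-1} with the same inner products as f
    is the orthogonal projection of f, hence the best approximation. *)
Lemma best_approximation (psi : nat -> T -> K) (f : T -> K) (a b : nat -> K) n m :
  (forall i, L2 mu (psi i)) -> L2 mu f -> (m <= n)%N ->
  (forall j, (j < n)%N -> ip (synth psi a n) (psi j) = ip f (psi j)) ->
  L2sq mu (fun x => f x - synth psi a n x) <=
  L2sq mu (fun x => f x - synth psi b m x).
Proof.
move=> psi2 f2 mn orth.
pose h i := if (i < m)%N then b i else 0.
have -> : synth psi b m = synth psi h n.
  rewrite (@synth_head _ _ _ _ _ h m)// => [|i]; last by rewrite /h ltnNge => ->.
  by apply/funext => x; apply: eq_bigr => i _; rewrite /h ltn_ord.
have S2 c : L2 mu (synth psi c n) by exact: L2_synth.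
have -> : (fun x => f x - synth psi h n x) = (fun x =>
    (f x - synth psi a n x) - synth psi (fun i => h i - a i) n x).
  by apply/funext => x; rewrite -synthB opprB addrA subrK.
rewrite [leRHS]L2sqB//; last exact: L2B.
have -> : ip (fun x => f x - synth psi a n x)
             (synth psi (fun i => h i - a i) n) = 0.
  rewrite ip_sumr//; last exact: L2B.
  by rewrite big1// => j _; rewrite ipBl// orth// subrr mulr0.
by rewrite scalar_re0 mulr0 subr0 lerDl L2sq_ge0.
Qed.

End Riesz_basis.

Lemma sum_enumeration (V : nmodType) (enum : nat -> nat * nat) (dec : nat * nat -> nat)
    (H : nat * nat -> V) (N I J : nat) :
  cancel enum dec -> cancel dec enum ->
  (forall l, (N <= l)%N -> H (enum l) = 0) ->
  (forall p, ~~ ((p.1 < I)%N && (p.2 < J)%N) -> H p = 0) ->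
  \sum_(l < N) H (enum l) = \sum_(i < I) \sum_(j < J) H (i : nat, j : nat).
Proof.
move=> enumK decK HN HIJ.
pose box := [seq (i, j) | i <- iota 0 I, j <- iota 0 J].
have in_box p : (p \in box) = (p.1 < I)%N && (p.2 < J)%N.
  case: p => i j; apply/allpairsP/idP => /= [[[i' j'] /= []]|/andP[iI jJ]].
    by rewrite !mem_iota/= !add0n => iI jJ [-> ->]; rewrite iI.
  by exists (i, j); rewrite !mem_iota.
pose rowN := [seq enum l | l <- iota 0 N].
have sumN : \sum_(l < N) H (enum l) = \sum_(p <- rowN) H p.
  by rewrite big_map -(big_mkord xpredT (H \o enum)) /index_iota subn0.
have sumB : \sum_(i < I) \sum_(j < J) H (i : nat, j : nat) = \sum_(p <- box) H p.
  rewrite big_allpairs -(big_mkord xpredT (fun i => \sum_(j < J) H (i, j : nat))).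
  rewrite /index_iota subn0; apply: eq_bigr => i _.
  by rewrite -(big_mkord xpredT (fun j => H (i, j))) /index_iota subn0.
rewrite sumN sumB.
have restrict (s t : seq (nat * nat)) : (forall p, p \notin t -> H p = 0) ->
    \sum_(p <- s) H p = \sum_(p <- [seq p <- s | p \in t]) H p.
  move=> H0; rewrite big_filter [RHS]big_mkcond/=; apply: eq_bigr => p _.
  by case: ifPn => // /H0.
rewrite (restrict rowN box); last by move=> p; rewrite in_box; exact: HIJ.
rewrite (restrict box rowN) => [|p pN]; last first.
  rewrite -[p]decK HN// leqNgt; apply: contra pN => pN.
  by rewrite -[p]decK map_f// mem_iota.
apply: perm_big; apply: uniq_perm.
- by rewrite filter_uniq// map_inj_uniq ?iota_uniq//; exact: can_inj enumK.
- by rewrite filter_uniq// allpairs_uniq ?iota_uniq// => -[? ?] [? ?] _ _ [-> ->].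
- by move=> p; rewrite !mem_filter andbC.
Qed.

(** * Products of Riesz systems *)

Section slices.
Context {R : realType} {k : scalar_kind}.
Context {dx du : measure_display}.
Context {X : measurableType dx} {U : measurableType du}.
Variables (mu_x : {sigma_finite_measure set X -> \bar R})
          (mu_u : {sigma_finite_measure set U -> \bar R}).
Local Notation K := (scalar_field R k).
Local Notation mu := (mu_x \x mu_u)%E.

Lemma scalar_measurable_comp {d d'} {S : measurableType d} {T : measurableType d'}
    (f : T -> K) (g : S -> T) : measurable_fun [set: S] g ->
  scalar_measurable f -> scalar_measurable (fun x => f (g x)).
Proof.
move=> mg [fr fi]; split.
  exact: (measurableT_comp fr mg).
exact: (measurableT_comp fi mg).
Qed.

Lemma scalar_measurable_slice (h : X * U -> K) x : scalar_measurable h ->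
  scalar_measurable (fun u => h (x, u)).
Proof. by apply: scalar_measurable_comp; exact: pair1_measurable. Qed.

Lemma sqint_slices (h : X * U -> K) : scalar_measurable h ->
  sqint mu h = (\int[mu_x]_x sqint mu_u (fun u => h (x, u)))%E.
Proof.
move=> mh; rewrite /sqint fubini_tonelli1//; first exact: measurable_sqabsE.
by move=> x; rewrite lee_fin sqr_ge0.
Qed.

Lemma measurable_sqint_slices (h : X * U -> K) : scalar_measurable h ->
  measurable_fun [set: X] (fun x => sqint mu_u (fun u => h (x, u))).
Proof.
move=> mh.
apply: (measurable_fun_fubini_tonelli_F (m2 := mu_u)
  (fun z => (scalar_abs (h z) ^+ 2)%:E)); first exact: measurable_sqabsE.
by move=> x; rewrite lee_fin sqr_ge0.
Qed.

(** The slices need not be integrable, so Tonelli's theorem is applied to the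
    positive and the negative part of p. *)
Lemma measurable_Rintegral_slices (p : X * U -> R) : measurable_fun [set: X * U] p ->
  measurable_fun [set: X] (fun x => \int[mu_u]_u p (x, u)).
Proof.
move=> mp; have mpE : measurable_fun [set: X * U] (EFin \o p).
  exact/measurable_EFinP.
have mpos := measurable_fun_fubini_tonelli_F (m2 := mu_u) _
  (measurable_funepos mpE) (fun z => funepos_ge0 (EFin \o p) z).
have mneg := measurable_fun_fubini_tonelli_F (m2 := mu_u) _
  (measurable_funeneg mpE) (fun z => funeneg_ge0 (EFin \o p) z).
apply: (measurableT_comp (@fine_measurable R setT measurableT)).
rewrite (_ : (fun x => _) = (fun x => fubini_F mu_u (EFin \o p)^\+%E x -
   fubini_F mu_u (EFin \o p)^\-%E x)%E); first exact: emeasurable_funB.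
apply/funext => x; rewrite integralE /fubini_F.
by congr (_ - _)%E; apply: eq_integral => u _; rewrite ?funeposE ?funenegE.
Qed.

Lemma scalar_measurable_ip_slices (h : X * U -> K) (g : U -> K) :
  scalar_measurable h -> scalar_measurable g ->
  scalar_measurable (fun x => L2inner mu_u (fun u => h (x, u)) g).
Proof.
move=> mh mg.
have [hr hi] : scalar_measurable (fun z => h z * scalar_conj (g z.2)).
  apply: scalar_measurableM => //; apply: scalar_measurableJ.
  by apply: scalar_measurable_comp mg; exact: measurable_snd.
split.
  under eq_fun do rewrite scalar_re_ip.
  exact: measurable_Rintegral_slices hr.
under eq_fun do rewrite scalar_im_ip.
exact: measurable_Rintegral_slices hi.
Qed.

Definition tensor (g : X -> K) (h : U -> K) : X * U -> K :=
  fun z => g z.1 * h z.2.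

Lemma scalar_measurable_tensor g h :
  scalar_measurable g -> scalar_measurable h -> scalar_measurable (tensor g h).
Proof.
move=> mg mh; apply: scalar_measurableM.
  by apply: scalar_measurable_comp mg; exact: measurable_fst.
by apply: scalar_measurable_comp mh; exact: measurable_snd.
Qed.

Lemma L2_tensor g h : L2 mu_x g -> L2 mu_u h -> L2 mu (tensor g h).
Proof.
move=> g2 h2; have mg := L2_measurable g2; have mh := L2_measurable h2.
apply/L2P; split; first exact: scalar_measurable_tensor.
rewrite sqint_slices; last exact: scalar_measurable_tensor.
have -> : (\int[mu_x]_x sqint mu_u (fun u => tensor g h (x, u)) =
    \int[mu_x]_x ((L2sq mu_u h)%:E * (scalar_abs (g x) ^+ 2)%:E))%E.
  apply: eq_integral => x _.
  by rewrite -L2_sqint// muleC -sqintZ.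
rewrite ge0_integralZl_EFin//.
- by rewrite -/(sqint mu_x g) L2_sqint// -EFinM ltry.
- by move=> x _; rewrite lee_fin sqr_ge0.
- exact: measurable_sqabsE.
- exact: L2sq_ge0.
Qed.

Variables (phi : nat -> X -> K) (chi : nat -> U -> K) (ax bx au bu : R).
Hypothesis phi_rs : Riesz_system mu_x phi ax bx.
Hypothesis chi_rs : Riesz_system mu_u chi au bu.
Let phi2 := Riesz_L2 phi_rs.
Let chi2 := Riesz_L2 chi_rs.
Let ax0 : 0 < ax := Riesz_gt0 phi_rs.
Let au0 : 0 < au := Riesz_gt0 chi_rs.
Let bu0 : 0 < bu := lt_le_trans au0 (Riesz_le chi_rs).
Let bx0 : 0 < bx := lt_le_trans ax0 (Riesz_le phi_rs).

(** The sum of a_j tensor chi_j, with functions a_j for coefficients. *)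
Definition mixed_sum (a : nat -> X -> K) J : X * U -> K :=
  fun z => \sum_(j < J) a j z.1 * chi j z.2.

Lemma scalar_measurable_mixed_sum (a : nat -> X -> K) J : (forall j, scalar_measurable (a j)) ->
  scalar_measurable (mixed_sum a J).
Proof.
move=> ma; apply: (@scalar_measurable_sum _ _ _ _ J (fun j => tensor (a j) (chi j))).
by move=> j; apply: scalar_measurable_tensor => //; exact: L2_measurable (chi2 j).
Qed.

(** The Riesz inequality of the chi_j holds for the slice at each x, with the
    coefficients a_j(x); integrate it over x. *)
Lemma sqint_mixed_sum (a : nat -> X -> K) J : (forall j, scalar_measurable (a j)) ->
  (au%:E * \sum_(j < J) sqint mu_x (a j) <= sqint mu (mixed_sum a J))%E /\
  (sqint mu (mixed_sum a J) <= bu%:E * \sum_(j < J) sqint mu_x (a j))%E.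
Proof.
move=> ma; have mm := scalar_measurable_mixed_sum J ma.
have slice x : sqint mu_u (fun u => mixed_sum a J (x, u)) =
    (L2sq mu_u (synth chi (fun j => a j x) J))%:E.
  by rewrite -L2_sqint//; exact: L2_synth.
have sumE (b : R) : 0 <= b -> (b%:E * \sum_(j < J) sqint mu_x (a j) =
    \int[mu_x]_x (b * sqsum J (fun j => a j x))%:E)%E.
  move=> b0; rewrite -(@ge0_integral_sum _ _ _ mu_x _ measurableT _
    (fun (j : 'I_J) x => (scalar_abs (a j x) ^+ 2)%:E)); last 2 first.
  - by move=> j; exact: measurable_sqabsE.
  - by move=> j x _; rewrite lee_fin sqr_ge0.
  rewrite -ge0_integralZl_EFin//; last 2 first.
  - by move=> x _; rewrite sume_ge0// => j _; rewrite lee_fin sqr_ge0.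
  - by apply: emeasurable_sum => j; exact: measurable_sqabsE.
  by apply: eq_integral => x _; rewrite sumEFin -EFinM.
have mS (b : R) : measurable_fun [set: X] (fun x => (b * sqsum J (fun j => a j x))%:E).
  apply/measurable_EFinP; apply: measurable_funM => //.
  by apply: measurable_sum => j; exact: measurable_sqabs.
rewrite sqint_slices// !sumE ?(ltW au0) ?(ltW bu0)//; split.
  apply: ge0_le_integral => //.
  - by move=> x _; rewrite lee_fin mulr_ge0 ?sqsum_ge0 ?(ltW au0).
  - exact: measurable_sqint_slices.
  - by move=> x _; rewrite slice lee_fin; exact: (Riesz_lower chi_rs).
apply: ge0_le_integral => //.
- by move=> x _; exact: sqint_ge0.
- exact: measurable_sqint_slices.
- by move=> x _; rewrite slice lee_fin; exact: (Riesz_upper chi_rs).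
Qed.

Definition double_sum (D : nat -> nat -> K) I J : X * U -> K :=
  mixed_sum (fun j => synth phi (fun i => D i j) I) J.

Lemma L2_double_sum (D : nat -> nat -> K) I J : L2 mu (double_sum D I J).
Proof.
apply: (@L2_sum _ _ _ _ _ J (fun j => tensor (synth phi (fun i => D i j) I) (chi j))).
by move=> j; apply: L2_tensor => //; exact: L2_synth.
Qed.

Lemma L2sq_double_sum (D : nat -> nat -> K) I J : let s := \sum_(j < J) sqsum I (fun i => D i j) in
  au * ax * s <= L2sq mu (double_sum D I J) <= bu * bx * s.
Proof.
have S2 j : L2 mu_x (synth phi (fun i => D i j) I) by exact: L2_synth.
have [lo up] := sqint_mixed_sum J (fun j => L2_measurable (S2 j)).
move: lo up; rewrite /= -/(double_sum D I J) L2_sqint; last exact: L2_double_sum.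
under eq_bigr do rewrite L2_sqint//.
rewrite sumEFin -!EFinM !lee_fin => lo up; apply/andP; split.
  apply: le_trans lo; rewrite -mulrA ler_pM2l// mulr_sumr.
  by apply: ler_sum => j _; exact: (Riesz_lower phi_rs).
apply: le_trans up _; rewrite -mulrA ler_pM2l// mulr_sumr.
by apply: ler_sum => j _; exact: (Riesz_upper phi_rs).
Qed.

Section enumeration.
Variables (enum : nat -> nat * nat) (dec : nat * nat -> nat).
Hypotheses (enumK : cancel enum dec) (decK : cancel dec enum).

Definition product_system (l : nat) : X * U -> K :=
  fun z => phi (enum l).1 z.1 * chi (enum l).2 z.2.

Lemma sum_double_sum (H : nat * nat -> K) N I J :
  (forall l, (N <= l)%N -> H (enum l) = 0) ->
  (forall p, ~~ ((p.1 < I)%N && (p.2 < J)%N) -> H p = 0) ->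
  synth product_system (H \o enum) N = double_sum (fun i j => H (i, j)) I J.
Proof.
move=> HN HIJ; apply/funext => z; rewrite /synth /product_system.
rewrite (sum_enumeration (H := fun p => H p * (phi p.1 z.1 * chi p.2 z.2)) (I := I) (J := J)
  enumK decK).
- rewrite exchange_big; apply: eq_bigr => j _ /=; rewrite /synth mulr_suml.
  by apply: eq_bigr => i _; rewrite mulrA.
- by move=> l /HN ->; rewrite mul0r.
- by move=> p /HIJ ->; rewrite mul0r.
Qed.

(** A finite combination of the products is a finite double sum, for which the
    two Riesz inequalities multiply. *)
Lemma product_Riesz_system : Riesz_system mu product_system (au * ax) (bu * bx).
Proof.
suff main N (c : nat -> K) : au * ax * sqsum N c <= L2sq mu (synth product_system c N) <=
    bu * bx * sqsum N c.
  split=> [l||| N c|N c].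
  - by apply: (L2_tensor (g := phi _) (h := chi _)).
  - exact: mulr_gt0.
  - by apply: ler_pM; [exact: ltW|exact: ltW|exact: Riesz_le chi_rs|exact: Riesz_le phi_rs].
  - by have /andP[] := main N c.
  - by have /andP[] := main N c.
pose H p := if (dec p < N)%N then c (dec p) else 0.
pose I := (\max_(l < N) (enum l).1).+1; pose J := (\max_(l < N) (enum l).2).+1.
have HN l : (N <= l)%N -> H (enum l) = 0 by rewrite /H enumK ltnNge => ->.
have HIJ p : ~~ ((p.1 < I)%N && (p.2 < J)%N) -> H p = 0.
  rewrite /H; case: ifP => // pN; rewrite -[p]decK !ltnS.
  rewrite (leq_bigmax (F := fun l : 'I_N => (enum l).1) (Ordinal pN)).
  by rewrite (leq_bigmax (F := fun l : 'I_N => (enum l).2) (Ordinal pN)).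
have -> : synth product_system c N = double_sum (fun i j => H (i, j)) I J.
  rewrite -(sum_double_sum HN HIJ); apply/funext => z; apply: eq_bigr => l _.
  by rewrite /= /H enumK ltn_ord.
suff -> : sqsum N c = \sum_(j < J) sqsum I (fun i => H (i, j : nat)).
  exact: L2sq_double_sum.
rewrite /sqsum exchange_big/=.
rewrite -(sum_enumeration (H := fun p => scalar_abs (H p) ^+ 2) (N := N) enumK decK).
- by apply: eq_bigr => l _; rewrite /H enumK ltn_ord.
- by move=> l /HN ->; rewrite scalar_abs0 expr0n.
- by move=> p /HIJ ->; rewrite scalar_abs0 expr0n.
Qed.

End enumeration.
End slices.

(** * Completeness of the products, and the theorem *)

Section product_completeness.
Context {R : realType} {k : scalar_kind}.
Context {dx du : measure_display}.
Context {X : measurableType dx} {U : measurableType du}.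
Variables (mu_x : {sigma_finite_measure set X -> \bar R})
          (mu_u : {sigma_finite_measure set U -> \bar R}).
Local Notation K := (scalar_field R k).
Local Notation mu := (mu_x \x mu_u)%E.
Variables (phi : nat -> X -> K) (chi : nat -> U -> K) (ax bx au bu : R).
Hypothesis phi_rs : Riesz_system mu_x phi ax bx.
Hypothesis chi_rs : Riesz_system mu_u chi au bu.
Let chi2 := Riesz_L2 chi_rs.
Let bu0 : 0 < bu := lt_le_trans (Riesz_gt0 chi_rs) (Riesz_le chi_rs).

(** Bessel's inequality for the slices in L^2(U), integrated over x; for the
    other slices the bound is infinite. *)
Lemma L2_ip_slices (f : X * U -> K) l : L2 mu f ->
  L2 mu_x (fun x => L2inner mu_u (fun u => f (x, u)) (chi l)).
Proof.
move=> f2; have mf := L2_measurable f2; apply/L2P.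
have mip : scalar_measurable (fun x => L2inner mu_u (fun u => f (x, u)) (chi l)).
  by apply: scalar_measurable_ip_slices => //; exact: L2_measurable (chi2 l).
split => //; apply: (@le_lt_trans _ _ (bu%:E * sqint mu f)%E); last first.
  by rewrite L2_sqint// -EFinM ltry.
rewrite sqint_slices// -ge0_integralZl_EFin ?(ltW bu0)//; last 2 first.
- by move=> x _; exact: sqint_ge0.
- exact: measurable_sqint_slices.
apply: ge0_le_integral => //.
- by move=> x _; rewrite lee_fin sqr_ge0.
- exact: measurable_sqabsE.
- by apply: measurable_funeM; exact: measurable_sqint_slices.
move=> x _; have mfx := scalar_measurable_slice x mf.
have [fxy|] := ltP (sqint mu_u (fun u => f (x, u))) +oo%E; last first.
  by rewrite leye_eq => /eqP ->; rewrite gt0_muley ?leey// lte_fin.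
have fx2 : L2 mu_u (fun u => f (x, u)) by apply/L2P.
rewrite L2_sqint// -EFinM lee_fin; exact: ip_psi_le chi_rs _ _ fx2.
Qed.

(** Project every slice f(x, .) onto the span of chi_0, ..., chi_{n-1}. The
    squared distances tend to 0 because the chi_j are complete, and they are
    dominated by the squared norms of the slices. *)
Lemma slice_projection_cvg (f : X * U -> K) : L2_complete mu_u chi -> L2 mu f ->
  exists a : nat -> nat -> X -> K, (forall n j, L2 mu_x (a n j)) /\
    sqint mu (fun z => f z - mixed_sum chi (a n) n z) @[n --> \oo] --> 0%E.
Proof.
move=> compl f2; have mf := L2_measurable f2.
have [M MP] := choice (fun n => finite_section chi_rs n).
pose b x l := L2inner mu_u (fun u => f (x, u)) (chi l).
pose a n j x := \sum_(l < n) b x l * M n l j.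
have a2 n j : L2 mu_x (a n j).
  apply: (@L2_sum _ _ _ _ _ n (fun l x => b x l * M n l j)) => l.
  by under eq_fun do rewrite mulrC; apply: L2Z; exact: L2_ip_slices.
exists a; split => //.
have mg n : scalar_measurable (fun z => f z - mixed_sum chi (a n) n z).
  apply: scalar_measurableB => //; apply: (scalar_measurable_mixed_sum chi_rs) => j.
  exact: L2_measurable (a2 n j).
pose F n x := sqint mu_u (fun u => f (x, u) - mixed_sum chi (a n) n (x, u)).
have FE n : sqint mu (fun z => f z - mixed_sum chi (a n) n z) = (\int[mu_x]_x F n x)%E.
  by rewrite sqint_slices.
under eq_fun do rewrite FE.
have orth x n j : (j < n)%N ->
    L2inner mu_u (synth chi (fun i => a n i x) n) (chi j) = b x j.
  by move=> jn; exact: (MP n (b x) j jn).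
(* domination and convergence both follow: compare with the combination 0,
   and with a combination close to the slice *)
have best x n c m : (m <= n)%N -> L2 mu_u (fun u => f (x, u)) ->
    (F n x <= (L2sq mu_u (fun u => f (x, u) - synth chi c m u))%:E)%E.
  move=> mn fx2; rewrite /F L2_sqint; last first.
    exact: (L2B fx2 (L2_synth (fun i => a n i x) n chi2)).
  rewrite lee_fin.
  exact: (best_approximation (a := fun i => a n i x) c chi2 fx2 mn (orth x n)).
have F_cvg x : L2 mu_u (fun u => f (x, u)) -> F ^~ x @ \oo --> 0%E.
  move=> fx2; have Ffin n : F n x \is a fin_num.
    rewrite ge0_fin_numE ?sqint_ge0//.
    by apply: le_lt_trans (best x n (fun=> 0) 0%N (leq0n _) fx2) _; rewrite ltry.
  apply/fine_cvgP; split; first by apply: nearW.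
  apply/cvgrPdist_le => e e0.
  have se0 : 0 < Num.sqrt e by rewrite sqrtr_gt0.
  have [m [c cP]] := compl _ fx2 _ se0.
  exists m => // n /= mn; rewrite sub0r normrN ger0_norm ?fine_ge0 ?sqint_ge0//.
  rewrite -lee_fin fineK//; apply: le_trans (best x n c m mn fx2) _.
  rewrite -L2_sqint; last exact: (L2B fx2 (L2_synth c m chi2)).
  by move: cP; rewrite L2norm_ltE// sqr_sqrtr ?(ltW e0)// => /ltW.
pose g x := sqint mu_u (fun u => f (x, u)).
have g_int : mu_x.-integrable [set: X] g.
  apply/integrableP; split; first exact: measurable_sqint_slices.
  under eq_integral do rewrite gee0_abs ?sqint_ge0//.
  by rewrite -sqint_slices// L2_sqint// ltry.
have F_meas n : measurable_fun [set: X] (F n).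
  exact: (measurable_sqint_slices mu_u (mg n)).
have F_g n x : (F n x <= g x)%E.
  have [gy|] := ltP (g x) +oo%E; last by rewrite leye_eq => /eqP ->; rewrite leey.
  have fx2 : L2 mu_u (fun u => f (x, u)).
    by apply/L2P; split => //; exact: scalar_measurable_slice.
  apply: le_trans (best x n (fun=> 0) 0%N (leq0n _) fx2) _.
  rewrite /g L2_sqint// lee_fin le_eqVlt; apply/orP; left; apply/eqP.
  by congr (L2sq _ _); apply/funext => u; rewrite /synth big_ord0 subr0.
have F_ae : {ae mu_x, forall x, [set: X] x -> F ^~ x @ \oo --> 0%E}.
  have := integrable_ae measurableT g_int; apply: filterS => x gx _.
  apply: F_cvg; apply/L2P; split; first exact: scalar_measurable_slice.
  by rewrite -ge0_fin_numE ?sqint_ge0//; exact: gx.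
have F_dom : {ae mu_x, forall x n, [set: X] x -> (`|F n x| <= g x)%E}.
  by apply: aeW => x n _; rewrite gee0_abs ?sqint_ge0.
have [_ _] := dominated_convergence measurableT F_meas (measurable_cst 0%E)
  F_ae g_int F_dom.
by rewrite integral0.
Qed.

(** Approximate f by a mixed sum with coefficients in L^2(X), and each of these
    coefficients by a combination of the phi_i. *)
Lemma product_complete (enum : nat -> nat * nat) (dec : nat * nat -> nat) :
  cancel enum dec -> cancel dec enum ->
  L2_complete mu_x phi -> L2_complete mu_u chi ->
  L2_complete mu (product_system phi chi enum).
Proof.
move=> enumK decK phi_compl chi_compl f f2 e e0.
have e40 : 0 < e ^+ 2 / 4 by rewrite divr_gt0// exprn_gt0.
have [a [a2 a_cvg]] := slice_projection_cvg chi_compl f2.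
have [n fn] : exists n, (sqint mu (fun z => (f z - mixed_sum chi (a n) n z)%R) < (e ^+ 2 / 4)%:E)%E.
  move/fine_cvgP : a_cvg => [[N1 _ fin] /cvgrPdist_lt /(_ _ e40) [N2 _ small]].
  exists (maxn N1 N2).
  have := small (maxn N1 N2) (leq_maxr _ _).
  rewrite sub0r normrN ger0_norm ?fine_ge0 ?sqint_ge0//= => h.
  by rewrite -[ltLHS]fineK ?lte_fin//; apply: fin; rewrite /= leq_maxl.
(* each of the n coefficients is approximated up to del *)
have [del del0 del_small] : exists2 del : R, 0 < del & bu * (n%:R * del ^+ 2) < e ^+ 2 / 4.
  have B0 : 0 < bu * (n%:R + 1) by rewrite mulr_gt0// ltr_wpDl.
  exists (Num.sqrt (e ^+ 2 / 4 / (bu * (n%:R + 1)))).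
    by rewrite sqrtr_gt0 divr_gt0.
  rewrite sqr_sqrtr; last by rewrite ltW// divr_gt0.
  set q := _ / _; have q0 : 0 < q by exact: divr_gt0.
  rewrite [ltRHS](_ : _ = q * (bu * (n%:R + 1))); last by rewrite divfK ?gt_eqF.
  rewrite -subr_gt0 (_ : _ - _ = bu * q); last by ring.
  exact: mulr_gt0.
have coef j : exists Nd : nat * (nat -> K),
    (L2norm mu_x (fun x => (a n j x - \sum_(i < Nd.1) Nd.2 i * phi i x)%R) < del%:E)%E.
  by have [N [c cP]] := phi_compl _ (a2 n j) _ del0; exists (N, c).
have [Nd NdP] := choice coef.
pose I := (\max_(j < n) (Nd j).1).+1.
pose H p := if (p.1 < (Nd p.2).1)%N && (p.2 < n)%N then (Nd p.2).2 p.1 else 0.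
pose N := (\max_(p : 'I_I * 'I_n) dec (p.1 : nat, p.2 : nat)).+1.
have HIJ p : ~~ ((p.1 < I)%N && (p.2 < n)%N) -> H p = 0.
  rewrite /H; case: ifP => // /andP[p1 p2]; rewrite p2 andbT ltnS.
  rewrite (leq_trans (ltnW p1))//.
  exact: (leq_bigmax (F := fun j : 'I_n => (Nd j).1) (Ordinal p2)).
have HN l : (N <= l)%N -> H (enum l) = 0.
  move=> Nl; apply: HIJ; apply/negP => /andP[p1 p2].
  move: Nl; rewrite leqNgt => /negP; apply; rewrite ltnS.
  have := leq_bigmax (F := fun p : 'I_I * 'I_n => dec (p.1 : nat, p.2 : nat))
    (Ordinal p1, Ordinal p2).
  by rewrite /= -surjective_pairing enumK.
exists N, (H \o enum).
rewrite -[X in L2norm _ X]/(fun z => f z - synth (product_system phi chi enum) (H \o enum) N z).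
rewrite (sum_double_sum phi chi enumK decK HN HIJ).
pose r j x := a n j x - synth phi (fun i => H (i, j)) I x.
have split_f : (fun z => f z - double_sum phi chi (fun i j => H (i, j)) I n z) =
    (fun z => (f z - mixed_sum chi (a n) n z) + mixed_sum chi r n z).
  apply/funext => z; rewrite -addrA; congr (_ + _).
  rewrite /double_sum /mixed_sum -[X in _ = X + _]sumrN -big_split/= -sumrN.
  by apply: eq_bigr => j _; rewrite /r; ring.
rewrite L2norm_ltE// split_f.
have mr j : scalar_measurable (r j).
  apply: L2_measurable; apply: L2B => //; apply: L2_synth; exact: Riesz_L2 phi_rs.
have rsmall (j : 'I_n) : (sqint mu_x (r j) <= (del ^+ 2)%:E)%E.
  rewrite ltW// -L2norm_ltE//; have := NdP j; congr (L2norm _ _ < _)%E.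
  apply/funext => x; rewrite /r; congr (_ - _).
  have jI : ((Nd j).1 <= I)%N.
    exact: leqW (leq_bigmax (F := fun j : 'I_n => (Nd j).1) j).
  rewrite -(sum_truncate (fun i => (Nd j).2 i * phi i x) jI).
  apply: eq_bigr => i _; rewrite /H/= ltn_ord andbT.
  by case: ifP => //; rewrite mul0r.
have mixed_small : (sqint mu (mixed_sum chi r n) < (e ^+ 2 / 4)%:E)%E.
  have [_ up] := sqint_mixed_sum mu_x chi_rs n mr.
  apply: le_lt_trans up _.
  apply: (@le_lt_trans _ _ (bu%:E * \sum_(j < n) (del ^+ 2)%:E)%E).
    by apply: lee_wpmul2l; [rewrite lee_fin ltW|apply: lee_sum => j _].
  by rewrite sumEFin -EFinM lte_fin sumr_const card_ord -[_ *+ n]mulr_natl.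
have mfa : scalar_measurable (fun z => f z - mixed_sum chi (a n) n z).
  apply: scalar_measurableB; first exact: L2_measurable f2.
  apply: (scalar_measurable_mixed_sum chi_rs) => j.
  exact: L2_measurable (a2 n j).
apply: le_lt_trans (sqintD mu mfa (scalar_measurable_mixed_sum chi_rs n mr)) _.
apply: (@lt_le_trans _ _ (2%:E * ((e ^+ 2 / 4)%:E + (e ^+ 2 / 4)%:E))%E).
  by rewrite lte_pmul2l// lteD.
by rewrite -EFinD -EFinM lee_fin; lra.
Qed.

End product_completeness.

Theorem mainTheorem2 (R : realType) (k : scalar_kind)
  (n m : nat) (dx du : measure_display)
  (X : measurableType dx) (U : measurableType du)
  (iX : X -> 'rV[R]_n) (iU : U -> 'rV[R]_m)
  (iX_inj : injective iX) (iU_inj : injective iU)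
  (mu_x : {sigma_finite_measure set X -> \bar R})
  (mu_u : {sigma_finite_measure set U -> \bar R})
  (F : X * U -> X)
  (F_meas : measurable_fun [set: X * U] F)
  (F_int : vector_integrable (mu_x \x mu_u)%E (fun z => iX (F z)))
  (F_push : has_bounded_density (pushforward (mu_x \x mu_u)%E F) mu_x)
  (psi_x : nat -> X -> scalar_field R k) (psi_u : nat -> U -> scalar_field R k)
  (psi_x_free : L2_free mu_x psi_x) (psi_x_riesz : L2_Riesz_basis mu_x psi_x)
  (psi_u_free : L2_free mu_u psi_u) (psi_u_riesz : L2_Riesz_basis mu_u psi_u)
  (psi_xF_L2 : forall i : nat, L2 (mu_x \x mu_u)%E (fun z => psi_x i (F z)))
  (enum : nat -> nat * nat) (enum_bij : bijective enum) :
  let psi (l : nat) (z : X * U) : scalar_field R k :=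
    psi_x (enum l).1 z.1 * psi_u (enum l).2 z.2 in
  let Rmx (i j : nat) := L2inner (mu_x \x mu_u)%E (psi i) (psi j) in
  let Qx (i j : nat) :=
    L2inner (mu_x \x mu_u)%E (fun z => psi_x i (F z)) (psi j) in
  exists Rinv Kmx : nat -> nat -> scalar_field R k,
    [/\ l2_inverse Rmx Rinv,
        mx_prod Qx Rinv Kmx &
        forall i : nat,
          L2_series (mu_x \x mu_u)%E (Kmx i) psi (fun z => psi_x i (F z))].
Proof.
move=> psi Rmx Qx.
have [dec enumK decK] := enum_bij.
have [ax [bx rs_x]] := Riesz_basis_system psi_x_riesz.
have [au [bu rs_u]] := Riesz_basis_system psi_u_riesz.
have [_ compl_x _] := psi_x_riesz; have [_ compl_u _] := psi_u_riesz.
have [Rinv [RinvP expansion]] := Gram_inverse_expansion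
  (product_Riesz_system rs_x rs_u enumK decK)
  (product_complete rs_x rs_u enumK decK compl_x compl_u).
have [Kmx /all_and2 [KP Kseries]] :=
  choice (fun i => expansion _ (psi_xF_L2 i)).
by exists Rinv, Kmx.
Qed.
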